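(* Let $G=\mathbb{C}^d\rtimes\mathbb{C}$ be a simply connected complex almost Abelian Lie group with Lie algebra $\mathfrak{a}(\aleph)$, and let $J=J(\aleph)$. Let $\mathbf{L}\subset\mathfrak{a}(\aleph)$ be a Lie subalgebra and let $H_{\mathbf{L}}\subset G$ be the connected Lie subgroup with Lie algebra $\mathbf{L}$. 1. If $\mathbf{L}=\mathbf{W}\subset\mathbb{C}^d$ is an Abelian Lie subalgebra contained in $\mathbb{C}^d$, then $$H_{\mathbf{L}} = \{[w,0]\in\mathbb{C}^d\rtimes\mathbb{C} : w\in\mathbf{W}\} = \exp(\mathbf{L}).$$ 2. If $\mathbf{L}=\{(w+tv_0,t)\in\mathbb{C}^d\rtimes\mathbb{C} : w\in\mathbf{W},\ t\in\mathbb{C}\}$, where $v_0\in\mathbb{C}^d$ is fixed and $\mathbf{W}\subset\mathbb{C}^d$ is an $\mathrm{ad}_{e_0}$-invariant (i.e. $J$-invariant) vector subspace, then $$H_{\mathbf{L}} = \left\{\left[w+\frac{e^{tJ}-\mathbb{1}}{J}v_0,\ t\right]\in\mathbb{C}^d\rtimes\mathbb{C} : w\in\mathbf{W},\ t\in\mathbb{C}\right\}\cong \exp(\mathbf{W})\rtimes\mathbb{C}.$$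
   Context: A finitely-supported multiplicity function is a function $\aleph:\mathbb{C}\times\mathbb{N}\to\{0,1,2,\dots\}$ (with $\mathbb{N}=\{1,2,\dots\}$) that is nonzero at only finitely many pairs. Its Jordan matrix $J(\aleph)$ is the $d\times d$ block-diagonal matrix containing, for each $(\lambda,n)$, exactly $\aleph(\lambda,n)$ copies of the $n\times n$ Jordan block with eigenvalue $\lambda$. The Lie algebra $\mathfrak{a}(\aleph)$ is $\mathbb{C}^d\oplus\mathbb{C}e_0$ with bracket $[(v,t),(u,s)] = (tJu-sJv,0)$, so $\mathrm{ad}_{e_0}$ acts on $\mathbb{C}^d$ as $J$; it is almost Abelian (non-Abelian with a codimension 1 Abelian subalgebra), so $J\neq 0$. Lie subalgebras are complex; it is known that every Lie subalgebra of $\mathfrak{a}(\aleph)$ has one of the two forms in the claim. The simply connected group is $G=\mathbb{C}^d\rtimes\mathbb{C}$ with elements $[v,t]$, product $[v,t][u,s]=[v+e^{tJ}u,\,t+s]$ and exponential map $\exp(v,t)=\left[\sum_{n\ge1}\frac{(tJ)^{n-1}}{n!}v,\ t\right]$. The expression $\frac{e^{tJ}-\mathbb{1}}{J}$ denotes the series $\sum_{n=1}^\infty\frac{t^n}{n!}J^{n-1}$. The isomorphism in part 2 is of Lie groups, and $\exp(\mathbf{W})\rtimes\mathbb{C}$ denotes the subgroup $\{[w,t]: w\in\mathbf{W}, t\in\mathbb{C}\}$ of $G$. *)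

(* Defs.v *)
From HB Require Import structures.
From mathcomp Require Import all_boot all_order all_algebra finmap.
From mathcomp Require Import complex.
From mathcomp Require Import boolp classical_sets functions reals topology.
From mathcomp Require Import normedtype sequences derive.
Set Implicit Arguments.
Unset Strict Implicit.
Unset Printing Implicit Defensive.
Import Order.TTheory GRing.Theory Num.Theory.
Import numFieldNormedType.Exports.
Local Open Scope classical_set_scope.
Local Open Scope ring_scope.

(* The complex numbers.  The structure is named because the topology that the
   library puts on a [numClosedFieldType] is not inferred for the bare type
   [R[i]]. *)
Definition cplx (R : realType) : numClosedFieldType := R[i].

#[short(type="topGroupType")]
HB.structure Definition TopGroup := { T of Topological T & Group T }.

Section LieGroups.
Variable R : realType.
Local Notation C := (cplx R).

(* A chart is a homeomorphism from [ch_dom] onto [ch_cod], both open; the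
   values of [ch_fun] and [ch_inv] outside these sets are irrelevant. *)
Record chart (T : topologicalType) (k : nat) := Chart {
  ch_dom : set T;
  ch_cod : set 'rV[C]_k;
  ch_fun :> T -> 'rV[C]_k;
  ch_inv : 'rV[C]_k -> T;
  ch_dom_open : open ch_dom;
  ch_cod_open : open ch_cod;
  ch_funP : forall x, ch_dom x -> ch_cod (ch_fun x);
  ch_invP : forall z, ch_cod z -> ch_dom (ch_inv z);
  ch_funK : forall x, ch_dom x -> ch_inv (ch_fun x) = x;
  ch_invK : forall z, ch_cod z -> ch_fun (ch_inv z) = z;
  ch_fun_cont : {within ch_dom, continuous ch_fun};
  ch_inv_cont : {within ch_cod, continuous ch_inv} }.

(* [differentiable] is Frechet differentiability over the base field, which is
   the field of complex numbers here: on open sets it means holomorphy. *)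
Record complexLieGroup := ComplexLieGroup {
  lg_sort :> topGroupType;
  lg_dim : nat;
  lg_atlas : set (chart lg_sort lg_dim);
  lg_hausdorff : hausdorff_space lg_sort;
  lg_second_countable : @second_countable lg_sort;
  lg_cover : forall x : lg_sort, exists2 c, lg_atlas c & ch_dom c x;
  lg_transition : forall c c', lg_atlas c -> lg_atlas c' ->
    forall z, ch_cod c z -> ch_dom c' (ch_inv c z) ->
    differentiable (c' \o ch_inv c) z;
  lg_mul_cont : continuous (fun p : lg_sort * lg_sort => (p.1 * p.2)%g);
  lg_mul_holo : forall c1 c2 c, lg_atlas c1 -> lg_atlas c2 -> lg_atlas c ->
    forall z1 z2, ch_cod c1 z1 -> ch_cod c2 z2 ->
    ch_dom c (ch_inv c1 z1 * ch_inv c2 z2)%g ->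
    differentiable (fun z : 'rV[C]_lg_dim * 'rV[C]_lg_dim =>
      c (ch_inv c1 z.1 * ch_inv c2 z.2)%g) (z1, z2);
  lg_inv_cont : continuous (fun x : lg_sort => (x^-1)%g);
  lg_inv_holo : forall c c', lg_atlas c -> lg_atlas c' ->
    forall z, ch_cod c z -> ch_dom c' ((ch_inv c z)^-1)%g ->
    differentiable (fun z : 'rV[C]_lg_dim => c' ((ch_inv c z)^-1)%g) z }.

Definition holomorphic_map (K K' : complexLieGroup) (f : K -> K') : Prop :=
  continuous f /\
  forall c c', lg_atlas c -> lg_atlas c' ->
  forall z, ch_cod c z -> ch_dom c' (f (ch_inv c z)) ->
  differentiable (c' \o f \o ch_inv c) z.

Definition lie_isomorphic (K K' : complexLieGroup) : Prop :=
  exists f : K -> K', exists g : K' -> K,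
    [/\ cancel f g, cancel g f, {morph f : x y / (x * y)%g},
        holomorphic_map f & holomorphic_map g].

End LieGroups.

Definition posnat := {n : nat | (0 < n)%N}.

Definition multiplicity (R : realType) :=
  {fsfun cplx R * posnat -> nat with 0%N}.

Definition jordan_block (K : nzRingType) (a : K) (n : nat) : 'M[K]_n :=
  \matrix_(i < n, j < n) (a *+ (i == j) + ((j : nat) == i.+1)%:R).

Section AlmostAbelian.
Variables (R : realType) (aleph : multiplicity R).
Local Notation C := (cplx R).

(* The Jordan blocks, with multiplicities, in the order in which the support
   happens to be enumerated. *)
Definition jblocks : seq (C * posnat) :=
  flatten [seq nseq (aleph p) p | p <- finsupp aleph].

Definition jeigen (i : 'I_(size jblocks)) : C := (tnth (in_tuple jblocks) i).1.
Definition jsize (i : 'I_(size jblocks)) : nat :=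
  val (tnth (in_tuple jblocks) i).2.

Definition jdim : nat := (\sum_(i < size jblocks) jsize i)%N.

Definition jordan : 'M[C]_jdim :=
  \mxdiag_(i < size jblocks) jordan_block (jeigen i) (jsize i).

(* The carrier of both the Lie algebra and the group; [C^o] is the field of
   complex numbers seen as a vector space over itself. *)
Local Notation V := ('cV[C]_jdim * C^o)%type.

Definition lie_br (x y : V) : V :=
  (x.2 *: (jordan *m y.1) - y.2 *: (jordan *m x.1), 0).

Definition lie_subalgebra (L : {vspace V}) : Prop :=
  {in L &, forall x y, lie_br x y \in L}.

Definition lie_abelian (L : {vspace V}) : Prop :=
  {in L &, forall x y, lie_br x y = 0}.

Definition almost_abelian : Prop :=
  ~ lie_abelian fullv /\
  exists A : {vspace V},
    [/\ lie_subalgebra A, lie_abelian A & (\dim A).+1 = \dim {:V}].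

Definition expm n (A : 'M[C]_n) : 'M[C]_n :=
  limn (series (fun k => (k`!%:R : C)^-1 *: A ^+ k)).

(* (e^{tJ} - 1) / J, the term of index k being the one of order n = k + 1 *)
Definition expm_quo (t : C) : 'M[C]_jdim :=
  limn (series (fun k => (t ^+ k.+1 / (k.+1)`!%:R) *: jordan ^+ k)).

Definition aa_mul (x y : V) : V :=
  (x.1 + expm (x.2 *: jordan) *m y.1, x.2 + y.2).

Definition aa_exp (x : V) : V :=
  (limn (series (fun k => ((k.+1)`!%:R : C)^-1 *: ((x.2 *: jordan) ^+ k)))
     *m x.1, x.2).

(* An immersed complex Lie subgroup: a complex Lie group with an injective
   holomorphic immersive homomorphism into the group.  The ambient group is the
   vector space [V] as a complex manifold, so only charts of the source occur. *)
Record lie_subgroup := LieSubgroup {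
  ls_group :> complexLieGroup R;
  ls_incl : ls_group -> V;
  ls_inj : injective ls_incl;
  ls_mul : forall x y, ls_incl (x * y)%g = aa_mul (ls_incl x) (ls_incl y);
  ls_holo : forall c, lg_atlas c -> forall z, ch_cod c z ->
    differentiable (ls_incl \o ch_inv c) z;
  ls_immersion : forall c, lg_atlas c -> forall z, ch_cod c z ->
    injective ('d (ls_incl \o ch_inv c) z) }.

(* The tangent space of the group at its unit (0, 0) is [V] itself, and this is
   the identification that the exponential map is based on. *)
Definition has_lie_algebra (H : lie_subgroup) (L : {vspace V}) : Prop :=
  forall c, lg_atlas c -> ch_dom c (1%g : H) ->
    range ('d (@ls_incl H \o ch_inv c) (c 1%g)) = [set x | x \in L].

End AlmostAbelian.

Arguments ls_incl {R aleph} H _ : rename.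
Arguments aa_exp {R} aleph x.

(* Main.v *)
Require Import Defs.
From HB Require Import structures.
From mathcomp Require Import all_boot all_order all_algebra.
From mathcomp Require Import complex.
From mathcomp Require Import boolp classical_sets functions reals topology.
From mathcomp Require Import normedtype landau sequences derive.
From mathcomp Require Import interval_inference exp ring lra.
Import Order.TTheory GRing.Theory Num.Theory.
Import numFieldNormedType.Exports.
Local Open Scope classical_set_scope.
Local Open Scope ring_scope.
Set Implicit Arguments.
Unset Strict Implicit.

(** Straighten the subgroup: [(v, t) |-> (v - q(t) v0 + t v0, t)], where
    [q(t) = (e^{tJ} - 1) / J], maps the candidate for [H] onto the vector space
    [L].  By left translation the tangent space of [H] at [h] is the translate
    of [L], and after straightening it is [L] again, because [q' = exp] and [W]
    is [J]-invariant; so, modulo [L], the straightened inclusion of the connected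
    group [H] has zero differential and is constant, which gives one inclusion.
    (In part 1 the [t]-coordinate is constant for the same reason, and [v0 = 0].)
    For the other one, the straightened inclusion is onto a neighbourhood of [0]
    in [L], and the [n]-th powers of elements near the unit exhaust the candidate.
    As [q(t + s) = q(t) + e^{tJ} q(s)], the map [(v, t) |-> (v - q(t) v0, t)] is a
    group endomorphism; so [W] extended by the line is [H] itself with its
    inclusion composed with that map, and the isomorphism is the identity. *)

(** * Topology of the complex numbers *)

Section ComplexTopology.
Variable R : realType.
Local Notation C := (cplx R).
Local Notation Re := (@complex.Re R).
Local Notation Im := (@complex.Im R).
Implicit Types z w : C.

Lemma norm_real_complex (x : R) : `|(x%:C)%C : C| = (`|x|%:C)%C.
Proof. by rewrite normc_def /= expr0n addr0 sqrtr_sqr. Qed.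

Lemma norm_le_ReIm z : `|z| <= ((`|Re z| + `|Im z|)%:C)%C.
Proof.
rewrite [X in `|X| <= _]complexE rmorphD /=; apply: le_trans (ler_normD _ _) _.
rewrite normrM !norm_real_complex [`|'i%C|]normc_def /= expr0n /= add0r.
by rewrite expr1n sqrtr1 mul1r.
Qed.

Lemma normc_ge_Im z : ((`|Im z|%:C)%C : C) <= `|z|.
Proof.
rewrite !normc_def lecR -sqrtr_sqr; apply: ler_wsqrtr.
by rewrite lerDr sqr_ge0.
Qed.

Lemma Re_normE (U : normedModType C) (u : U) : (((Re `|u|)%:C)%C : C) = `|u|.
Proof. exact/RRe_real/normr_real. Qed.

Lemma Re_norm_ge0 (U : normedModType C) (u : U) : 0 <= Re `|u|.
Proof. by rewrite -lecR Re_normE; exact: normr_ge0. Qed.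

Lemma norm_le_real (U : normedModType C) (u : U) (r : R) :
  (`|u| <= ((r%:C)%C : C)) = (Re `|u| <= r).
Proof. by rewrite -Re_normE lecR. Qed.

Lemma cvg_complex (T : Type) (F : set_system T) (FF : Filter F) (f : T -> C) (l : C) :
  Re (f x) @[x --> F] --> Re l ->
  Im (f x) @[x --> F] --> Im l ->
  f x @[x --> F] --> l.
Proof.
move=> fre fim; apply/cvgrPdist_lt => e e0.
have eE : e = ((Re e)%:C)%C by rewrite RRe_real // gtr0_real.
have e20 : 0 < Re e / 2.
  by rewrite divr_gt0 //; rewrite eE ltcR in e0.
move/cvgrPdist_lt : fre => /(_ _ e20) fre.
move/cvgrPdist_lt : fim => /(_ _ e20) fim.
near=> x; apply: le_lt_trans (norm_le_ReIm _) _.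
rewrite eE ltcR [ltRHS]splitr.
have hr : `|Re l - Re (f x)| < Re e / 2 by near: x.
have hi : `|Im l - Im (f x)| < Re e / 2 by near: x.
by case: (l) (f x) hr hi => [a b] [c d] /= hr hi; apply: ltrD.
Unshelve. all: by end_near. Qed.

Lemma Re_continuous : continuous (Re : C -> R).
Proof.
move=> z; apply/(@cvgrPdist_lt _ _ _ (nbhs z)) => e e0.
have e0' : 0 < ((e%:C)%C : C) by rewrite ltcR.
apply/nbhs_normP; exists ((e%:C)%C : C) => // x /= xe; rewrite -ltcR.
apply: le_lt_trans xe.
by apply: le_trans (normc_ge_Re _); case: (z) (x) => [a b] [c d].
Qed.

Lemma Im_continuous : continuous (Im : C -> R).
Proof.
move=> z; have -> : Im = (fun w : C => Re (- 'i%C * w)).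
  by apply/funext => -[a b] /=; ring.
apply: (@continuous_comp C C R (fun w : C => - 'i%C * w) Re); last exact: Re_continuous.
exact: mulrl_continuous.
Qed.

Lemma real_complex_continuous : continuous (fun x : R => (x%:C)%C : C).
Proof. by move=> x; apply: cvg_complex; [exact: cvg_id | exact: cvg_cst]. Qed.

(** Compactness comes from the reals: the square is the continuous image of a product of two
    segments. *)
Lemma compact_complex_square (r : R) :
  compact [set z : C | `|Re z| <= r /\ `|Im z| <= r].
Proof.
pose f (p : R * R) : C := (p.1 +i* p.2)%C.
have -> : [set z : C | `|Re z| <= r /\ `|Im z| <= r] =
    f @` (`[- r, r]%classic `*` `[- r, r]%classic).
  apply/seteqP; split=> [[a b] /= [ha hb]|z [[a b] /= [ha hb] <-]] /=.
    by exists (a, b) => //=; rewrite !in_itv /= -!ler_norml.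
  by rewrite !ler_norml; move: ha hb; rewrite !in_itv.
apply: continuous_compact; last by apply: compact_setX; exact: segment_compact.
apply: continuous_subspaceT => -[a b]; apply: cvg_complex.
  exact: cvg_fst.
exact: cvg_snd.
Qed.

Lemma ler_mx_entry (K : numFieldType) m n (A : 'M[K]_(m, n)) i j :
  `|A i j| <= `|A|.
Proof.
rewrite [X in _ <= X]mx_normE.
have := le_bigmax 0%:nng (fun ij : 'I_m * 'I_n => `|A ij.1 ij.2|%:nng) (i, j).
exact.
Qed.

Lemma Re_norm_continuous (U : normedModType C) : continuous (fun u : U => Re `|u|).
Proof.
move=> u; apply: (@continuous_comp U C R Num.norm Re); last exact: Re_continuous.
exact: norm_continuous.
Qed.

Lemma cvg_Re_norm0 (U : normedModType C) : Re `|u| @[u --> (0 : U)] --> (0 : R).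
Proof.
have E : Re `|0 : U| = 0 by rewrite normr0.
by have := @Re_norm_continuous U 0; rewrite /continuous_at E.
Qed.

Lemma Re_normB_continuous (U : normedModType C) (u0 : U) :
  continuous (fun u : U => Re `|u - u0|).
Proof.
move=> u; apply: (@continuous_comp U U R (fun u => u - u0) (fun u => Re `|u|)).
  by apply: continuousD; [exact: (fun P => id)|exact: cst_continuous].
exact: Re_norm_continuous.
Qed.

(** The ball is a closed subset of a product of complex squares, one per coordinate, and such a
    product is compact. *)
Lemma compact_closed_ball_rV k (z0 : 'rV[C]_k) (r : R) :
  compact [set z : 'rV[C]_k | `|z - z0| <= ((r%:C)%C : C)].
Proof.
pose B (i : 'I_k) := [set z : C | `|Re (z - z0 ord0 i)| <= r /\
  `|Im (z - z0 ord0 i)| <= r].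
have cB i : compact (B i).
  have -> : B i = (fun w : C => w + z0 ord0 i) @`
      [set z : C | `|Re z| <= r /\ `|Im z| <= r].
    apply/seteqP; split=> [z Bz|_ [w Bw <-]]; last by rewrite /B /= addrK.
    by exists (z - z0 ord0 i); rewrite ?subrK.
  apply: continuous_compact; last exact: compact_complex_square.
  by apply: continuous_subspaceT => z; apply: continuousD;
    [exact: (fun P => id)|exact: cst_continuous].
apply: subclosed_compact (rV_compact cB) _.
  rewrite (_ : [set _ | _] = (fun z : 'rV[C]_k => Re `|z - z0|) @^-1` [set x | x <= r]).
    apply: closed_comp; last exact: closed_le.
    by move=> z _; exact: (@Re_normB_continuous _ z0 z).
  by apply/seteqP; split=> z /=; rewrite norm_le_real.
move=> z /= zr i.
have : `|(z - z0) ord0 i| <= ((r%:C)%C : C) := le_trans (ler_mx_entry _ _ _) zr.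
rewrite !mxE /B /=; set w : C := z ord0 i - _ => wr.
split; rewrite -lecR; apply: le_trans wr; [exact: normc_ge_Re | exact: normc_ge_Im].
Qed.

Lemma cvg_mx (K : numFieldType) (T : Type) (F : set_system T) (FF : Filter F) m n
    (f : T -> 'M[K]_(m, n)) (l : 'M[K]_(m, n)) :
  (forall i j, f x i j @[x --> F] --> l i j) -> f x @[x --> F] --> l.
Proof.
move=> fl A [P lP PA]; rewrite nbhs_filterE /=.
have H : \forall x \near F, forall ij : 'I_m * 'I_n, P ij.1 ij.2 (f x ij.1 ij.2).
  by apply: filter_forall => ij; apply: fl; exact: lP.
by apply: filterS H => x H; apply: PA => i j; exact: (H (i, j)).
Qed.

End ComplexTopology.

(** * The matrix exponential and [(e^{tA} - 1) / A] *)

Section TruncatedExponential.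
Variables (K : numFieldType) (V : lmodType K).
Implicit Types (t s : K) (v : nat -> V).

(** Cauchy product bookkeeping: the pair [(i, j)] is met on the antidiagonal [n = i + j]. *)
Lemma sum_triangle (f : nat -> nat -> V) N :
  \sum_(0 <= n < N) \sum_(0 <= i < n.+1) f i (n - i)%N =
  \sum_(0 <= i < N) \sum_(0 <= j < N | (i + j < N)%N) f i j.
Proof.
transitivity (\sum_(0 <= n < N) \sum_(0 <= i < N | (i <= n)%N) f i (n - i)%N).
  by apply: eq_big_nat => n /andP[_ nN]; rewrite (big_nat_widen _ _ _ _ _ nN).
rewrite (exchange_big_dep_nat xpredT) //=; apply: eq_big_nat => i /andP[_ iN].
rewrite -(big_nat_widenl i 0 N xpredT) //.
rewrite (_ : \sum_(i <= n < N) f i (n - i)%N =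
  \sum_(0 + i <= n < N) f i (n - i)%N) // big_addn.
rewrite (big_nat_widen _ _ _ _ _ (leq_subr i N)).
apply: eq_big => [j|j _]; last by rewrite addnK.
by rewrite ltn_subRL.
Qed.

Lemma expr_quo_fact t s n :
  (t + s) ^+ n.+1 / n.+1`!%:R = t ^+ n.+1 / n.+1`!%:R +
  \sum_(0 <= i < n.+1)
    (t ^+ i * s ^+ (n - i).+1) / (i`!%:R * (n - i).+1`!%:R).
Proof.
rewrite addrC exprDn big_ord_recr /= subnn expr0 mul1r binn mulr1n.
rewrite mulrDl [RHS]addrC; congr (_ + _).
rewrite mulr_suml big_mkord; apply: eq_bigr => i _.
have ile : (i <= n)%N by rewrite -ltnS.
rewrite subSn //.
have := bin_fact (ltnW (ltn_ord i)); rewrite subSn // => /(congr1 (fun k => k%:R : K)).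
rewrite !natrM => <-.
have c0 : ('C(n.+1, i)%:R : K) != 0 by rewrite pnatr_eq0 -lt0n bin_gt0 ltnW // ltnS.
rewrite -mulr_natr.
rewrite [(_ * _) * 'C(_, _)%:R]mulrC -mulf_div divff // mul1r.
by rewrite [s ^+ _ * _]mulrC.
Qed.

(* The truncated form of [q(t) + e^t q(s) = q(t + s)], with [v n] standing for
   [A ^+ n]: only the terms with [i + j >= N] remain. *)
Lemma trunc_expD t s v N :
  \sum_(0 <= n < N) (t ^+ n.+1 / n.+1`!%:R) *: v n +
  \sum_(0 <= i < N) \sum_(0 <= j < N)
    ((t ^+ i * s ^+ j.+1) / (i`!%:R * j.+1`!%:R)) *: v (i + j)%N -
  \sum_(0 <= n < N) ((t + s) ^+ n.+1 / n.+1`!%:R) *: v n =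
  \sum_(0 <= i < N) \sum_(0 <= j < N | ~~ (i + j < N)%N)
    ((t ^+ i * s ^+ j.+1) / (i`!%:R * j.+1`!%:R)) *: v (i + j)%N.
Proof.
have -> : \sum_(0 <= n < N) ((t + s) ^+ n.+1 / n.+1`!%:R) *: v n =
    \sum_(0 <= n < N) (t ^+ n.+1 / n.+1`!%:R) *: v n +
    \sum_(0 <= i < N) \sum_(0 <= j < N | (i + j < N)%N)
      ((t ^+ i * s ^+ j.+1) / (i`!%:R * j.+1`!%:R)) *: v (i + j)%N.
  rewrite -sum_triangle -big_split /=; apply: eq_bigr => n _.
  rewrite expr_quo_fact scalerDl; congr (_ + _).
  rewrite scaler_suml; apply: eq_big_nat => i /andP[_ i_n].
  by rewrite subnKC // -ltnS.
rewrite opprD addrACA subrr add0r -sumrB; apply: eq_bigr => i _.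
rewrite [X in X - _](bigID (fun j => (i + j < N)%N)) /=.
by rewrite addrAC subrr add0r.
Qed.

End TruncatedExponential.

(** * The remainder of the Cauchy product for the real exponential *)

Section RealRemainder.
Variable R : realType.
Implicit Types a b : R.

Lemma cvg_trunc_expR a :
  \sum_(0 <= n < N) a ^+ n.+1 / n.+1`!%:R @[N --> \oo] --> expR a - 1.
Proof.
have -> : (fun N => \sum_(0 <= n < N) a ^+ n.+1 / n.+1`!%:R) =
    (fun N => series (exp_coeff a) N.+1 - 1).
  apply/funext => N; rewrite /series /= big_nat_recl //= /exp_coeff /=.
  by rewrite expr0 fact0 divr1 addrAC subrr add0r.
apply: cvgB; last exact: cvg_cst.
by rewrite (cvg_shiftS (series (exp_coeff a))); exact: is_cvg_series_exp_coeff.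
Qed.

(** By [trunc_expD] with all [v n = 1], the remainder tends to [(e^a - 1) + e^a (e^b - 1) - (e^(a+b)
    - 1)], which vanishes by the functional equation of the real exponential. It later dominates the
    matrix remainder. *)
Lemma cvg_exp_remainder a b :
  \sum_(0 <= i < N) \sum_(0 <= j < N | ~~ (i + j < N)%N)
    (a ^+ i * b ^+ j.+1) / (i`!%:R * j.+1`!%:R) @[N --> \oo] --> (0 : R).
Proof.
have := fun N => @trunc_expD R R^o a b (fun=> 1) N; rewrite /GRing.scale /= => H.
have P N : \sum_(0 <= i < N) \sum_(0 <= j < N)
    (a ^+ i * b ^+ j.+1) / (i`!%:R * j.+1`!%:R) * 1 =
    series (exp_coeff a) N * (\sum_(0 <= n < N) b ^+ n.+1 / n.+1`!%:R).
  rewrite /series /= mulr_suml; apply: eq_bigr => i _; rewrite mulr_sumr.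
  by apply: eq_bigr => j _; rewrite mulr1 -mulf_div.
have -> : (fun N => \sum_(0 <= i < N) \sum_(0 <= j < N | ~~ (i + j < N)%N)
    (a ^+ i * b ^+ j.+1) / (i`!%:R * j.+1`!%:R)) =
  (fun N => \sum_(0 <= n < N) a ^+ n.+1 / n.+1`!%:R +
     series (exp_coeff a) N * (\sum_(0 <= n < N) b ^+ n.+1 / n.+1`!%:R) -
     \sum_(0 <= n < N) (a + b) ^+ n.+1 / n.+1`!%:R).
  apply/funext => N; rewrite -P.
  under [X in X + _ - _]eq_bigr do rewrite -[_ / _]mulr1.
  under [X in _ - X]eq_bigr do rewrite -[_ / _]mulr1.
  rewrite H; apply: eq_bigr => i _; apply: eq_bigr => j _; by rewrite mulr1.
rewrite (_ : nbhs 0 = nbhs (expR a - 1 + expR a * (expR b - 1) - (expR (a + b) - 1))).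
  2: by congr nbhs; rewrite expRD; ring.
apply: cvgB; last exact: cvg_trunc_expR.
apply: cvgD; first exact: cvg_trunc_expR.
by apply: cvgM; [exact: is_cvg_series_exp_coeff | exact: cvg_trunc_expR].
Qed.

End RealRemainder.

Section MatrixExponential.
Variable R : realType.
Local Notation C := (cplx R).
Variable n : nat.
Implicit Types (A : 'M[C]_n) (t s : C).

(** [M] is one plus the sum of all [|A i j|], so it bounds every absolute row sum of [A]; by
    induction [M ^+ k] bounds those of [A ^+ k]. The added one makes the powers of [M]
    nondecreasing. *)
Lemma expmx_entry_bound A : exists2 M : R, 1 <= M &
  forall k i j, `|(A ^+ k) i j| <= (((M ^+ k)%:C)%C : C).
Proof.
pose N : C := 1 + \sum_i \sum_j `|A i j|.
have N1 : 1 <= N by rewrite lerDl; do 2! apply: sumr_ge0 => ? _.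
have NE : ((complex.Re N)%:C)%C = N by apply/RRe_real/ger0_real/(le_trans ler01).
exists (complex.Re N); first by rewrite -lecR NE.
have row i : \sum_j `|A i j| <= N.
  apply: (@le_trans _ _ (\sum_i \sum_j `|A i j|)); last by rewrite lerDr.
  rewrite [leRHS](bigD1 i) //= lerDl; do 2! apply: sumr_ge0 => ? _.
  by [].
have bound k : forall i, \sum_j `|(A ^+ k) i j| <= N ^+ k.
  elim: k => [|k IH] i.
    rewrite !expr0 (bigD1 i) //= big1 ?addr0 => [|j ji].
      by rewrite mxE eqxx normr1.
    by rewrite mxE eq_sym (negPf ji) normr0.
  rewrite exprSr [A ^+ k * A]/(_ *m _).
  apply: (@le_trans _ _ (\sum_l `|(A ^+ k) i l| * N)).
    apply: (@le_trans _ _ (\sum_l \sum_j `|(A ^+ k) i l| * `|A l j|)).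
      rewrite exchange_big /=; apply: ler_sum => j _; rewrite mxE.
      by apply: le_trans (ler_norm_sum _ _ _) _; apply: ler_sum => l _; rewrite normrM.
    by apply: ler_sum => l _; rewrite -mulr_sumr ler_wpM2l.
  by rewrite -mulr_suml exprSr ler_wpM2r // (le_trans ler01).
move=> k i j; rewrite rmorphXn /= NE; apply: le_trans (bound k i).
by rewrite (bigD1 j) //= lerDl sumr_ge0.
Qed.

End MatrixExponential.

Section MatrixExponentialLimits.
Variable R : realType.
Local Notation C := (cplx R).

Lemma cvg_mx_entry (K : numFieldType) (T : Type) (F : set_system T) (FF : Filter F) m n
    (f : T -> 'M[K]_(m, n)) (l : 'M[K]_(m, n)) i j :
  f x @[x --> F] --> l -> f x i j @[x --> F] --> l i j.
Proof.
move=> fl; pose g (B : 'M[K]_(m, n)) := B i j.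
exact: (@continuous_cvg _ _ _ F FF f g l (@coord_continuous K m n i j l) fl).
Qed.

Lemma cvg_sum (K : numFieldType) (V : normedModType K) (T : Type) (F : set_system T)
    (FF : Filter F) (I : Type) (r : seq I) (f : T -> I -> V) (l : I -> V) :
  (forall i, f x i @[x --> F] --> l i) ->
  \sum_(i <- r) f x i @[x --> F] --> \sum_(i <- r) l i.
Proof.
move=> fl; elim: r => [|i r IH].
  by under eq_fun do rewrite big_nil; rewrite big_nil; exact: cvg_cst.
by under eq_fun do rewrite big_cons; rewrite big_cons; apply: cvgD.
Qed.

Lemma cvg_mulmx (K : numFieldType) (T : Type) (F : set_system T) (FF : Filter F) m n p
    (f : T -> 'M[K]_(m, n)) (g : T -> 'M[K]_(n, p)) (l : 'M[K]_(m, n)) (k : 'M[K]_(n, p)) :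
  f x @[x --> F] --> l -> g x @[x --> F] --> k ->
  f x *m g x @[x --> F] --> l *m k.
Proof.
move=> fl gk; apply: cvg_mx => i j.
under eq_fun do rewrite mxE.
rewrite mxE; apply: (@cvg_sum K K) => h.
by apply: cvgM; exact: cvg_mx_entry.
Qed.

(** The comparison test, applied to the real and imaginary parts separately; [part] treats both at
    once. *)
Lemma cvg_series_complex (c : nat -> C) (b : nat -> R) :
  (forall k, `|c k| <= (((b k)%:C)%C : C)) -> cvgn (series b) ->
  cvgn (series c).
Proof.
move=> cb cvb.
have b0 k : 0 <= b k by rewrite -lecR; apply: le_trans (cb k); exact: normr_ge0.
have part (g : C -> R) : g 0 = 0 -> {morph g : x y / x + y} ->
    (forall z, ((`|g z|%:C)%C : C) <= `|z|) -> cvgn (fun N => g (series c N)).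
  move=> g0 gD gle.
  rewrite (_ : (fun N => _) = series (g \o c)); last first.
    by apply/funext => N; rewrite /series /= (big_morph g gD g0).
  apply: normed_cvg; apply: series_le_cvg cvb => //= k.
  rewrite -lecR; exact: le_trans (gle _) (cb k).
have := part (@complex.Re R) erefl _ (@normc_ge_Re R).
move/(_ ltac:(by case=> [? ?] [])) => /cvg_ex[lr hr].
have := part (@complex.Im R) erefl _ (@normc_ge_Im R).
move/(_ ltac:(by case=> [? ?] [])) => /cvg_ex[li hi].
by apply/cvg_ex; exists (Complex lr li); apply: cvg_complex.
Qed.

Variable n : nat.
Implicit Types (A : 'M[C]_n) (t s : C).

Definition expq_trunc A t : nat -> 'M[C]_n :=
  series (fun k => (t ^+ k.+1 / (k.+1)`!%:R) *: A ^+ k).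

(* [(e^{tA} - 1) / A]; for [A = jordan aleph] it is convertible to [expm_quo]. *)
Definition expq A t : 'M[C]_n := limn (expq_trunc A t).

(** Since [1 <= M], the bound [M ^+ k] is relaxed to [M ^+ k.+1], which turns the majorant into a
    term of the exponential series at [M * |t|]. *)
Lemma expq_term_bound A : exists2 M : R, 1 <= M & forall k t i j,
  `|((t ^+ k.+1 / (k.+1)`!%:R) *: A ^+ k) i j| <=
  ((((M * complex.Re `|t|) ^+ k.+1 / (k.+1)`!%:R)%:C)%C : C).
Proof.
have [M M1 AM] := expmx_entry_bound A; exists M => // k t i j.
have M0 : 0 <= M by apply: le_trans M1.
rewrite mxE normrM; apply: le_trans (ler_wpM2l (normr_ge0 _) (AM k i j)) _.
rewrite normrM normrX normfV normr_nat -Re_normE.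
rewrite -(rmorph_nat (real_complex R)) -fmorphV -!rmorphXn -!rmorphM lecR.
rewrite mulrAC; apply: ler_wpM2r; first by rewrite invr_ge0 ler0n.
rewrite exprMn mulrC; apply: ler_wpM2r; last by rewrite ler_weXn2l.
by apply: exprn_ge0; exact: (Re_norm_ge0 (t : C^o)).
Qed.

Lemma cvg_expq A t : expq_trunc A t N @[N --> \oo] --> expq A t.
Proof.
have [M M1 AM] := expq_term_bound A.
pose x := M * complex.Re `|t|.
(* The majorant is the exponential series without its constant term. *)
have sc : cvgn (series (fun k => x ^+ k.+1 / (k.+1)`!%:R)).
  by apply/cvg_ex; exists (expR x - 1); exact: cvg_trunc_expR.
have ec i j : cvgn (series (fun k => ((t ^+ k.+1 / (k.+1)`!%:R) *: A ^+ k) i j)).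
  by apply: cvg_series_complex sc => k; exact: AM.
suff : cvgn (expq_trunc A t) by [].
apply/cvg_ex; exists (\matrix_(i, j)
  limn (series (fun k => ((t ^+ k.+1 / (k.+1)`!%:R) *: A ^+ k) i j))).
apply: cvg_mx => i j; rewrite mxE.
rewrite (_ : (fun N => _) = series (fun k => ((t ^+ k.+1 / (k.+1)`!%:R) *: A ^+ k) i j)).
  exact: ec.
by apply/funext => N; rewrite /expq_trunc /series /= summxE.
Qed.

End MatrixExponentialLimits.

Section MatrixExponentialAddition.
Variable R : realType.
Local Notation C := (cplx R).

Lemma cvg0_bound (T : Type) (F : set_system T) (FF : Filter F) (f : T -> C) (r : T -> R) :
  (\forall x \near F, `|f x| <= (((r x)%:C)%C : C)) -> r x @[x --> F] --> (0 : R) ->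
  f x @[x --> F] --> (0 : C).
Proof.
move=> fr r0.
have part (g : C -> R) : (forall z, ((`|g z|%:C)%C : C) <= `|z|) ->
    g (f x) @[x --> F] --> (0 : R).
  move=> gle; apply/norm_cvg0P.
  apply: (@squeeze_cvgr _ _ _ _ (fun=> 0) r) => //; last exact: cvg_cst.
  by apply: filterS fr => x fr; rewrite normr_ge0 -lecR (le_trans (gle _)).
by apply: cvg_complex; apply: part; [exact: normc_ge_Re|exact: normc_ge_Im].
Qed.

(** A linear map on matrices is a finite combination of the coordinate functions, with the values at
    the [delta_mx i j] as coefficients. *)
Lemma linear_mx_continuous (K : numFieldType) m n (V : normedModType K)
  (f : {linear 'M[K]_(m, n) -> V}) : continuous f.
Proof.
move=> B.
rewrite (_ : f = (fun B => \sum_i \sum_j B i j *: f (delta_mx i j)) :> (_ -> _)).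
  apply: (@cvg_sum K V _ (nbhs B)) => i; apply: (@cvg_sum K V _ (nbhs B)) => j.
  by apply: (@cvgZ _ _ _ (nbhs B)); [exact: coord_continuous | exact: cvg_cst].
apply/funext => D; rewrite {1}(matrix_sum_delta D) linear_sum; apply: eq_bigr => i _.
by rewrite linear_sum; apply: eq_bigr => j _; rewrite linearZ.
Qed.

Variable n : nat.
Implicit Types (A : 'M[C]_n) (t s : C).

Definition exp_trunc A t : nat -> 'M[C]_n :=
  series (fun k => (k`!%:R : C)^-1 *: (t *: A) ^+ k).

Lemma mx_exprS A k : A ^+ k.+1 = A *m A ^+ k.
Proof. exact: exprS. Qed.

Lemma exprZmx t A k : (t *: A) ^+ k = t ^+ k *: A ^+ k.
Proof.
elim: k => [|k IH]; first by rewrite !expr0 scale1r.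
by rewrite !mx_exprS IH -scalemxAl -scalemxAr scalerA exprS.
Qed.

(** After its constant term the exponential series is [A] times the quotient series; convergence of
    the former thus follows from that of the latter. *)
Lemma exp_truncS A t N : exp_trunc A t N.+1 = 1%:M + A *m expq_trunc A t N.
Proof.
rewrite /exp_trunc /expq_trunc /series /= big_nat_recl // fact0 invr1 scale1r.
rewrite expr0; congr (_ + _); rewrite mulmx_sumr; apply: eq_bigr => k _.
by rewrite exprZmx scalerA mulrC -scalemxAr mx_exprS.
Qed.

Lemma cvg_exp_trunc A t : exp_trunc A t N @[N --> \oo] --> 1%:M + A *m expq A t.
Proof.
rewrite -(cvg_shiftS (exp_trunc A t)).
under eq_fun do rewrite exp_truncS.
apply: cvgD; first exact: cvg_cst.
by apply: cvg_mulmx; [exact: cvg_cst | exact: cvg_expq].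
Qed.

Lemma expmE A t : expm (t *: A) = 1%:M + A *m expq A t.
Proof. by apply/cvg_lim; [exact: norm_hausdorff | exact: cvg_exp_trunc]. Qed.

Lemma cvg_expm A t : exp_trunc A t N @[N --> \oo] --> expm (t *: A).
Proof. by rewrite expmE; exact: cvg_exp_trunc. Qed.

Lemma expq0 A : expq A 0 = 0.
Proof.
apply/cvg_lim; first exact: norm_hausdorff.
rewrite (_ : expq_trunc A 0 = (fun=> 0)); first exact: cvg_cst.
apply/funext => N; rewrite /expq_trunc /series /= big1 // => k _.
by rewrite expr0n mul0r scale0r.
Qed.

Lemma expm0 A : expm (0 *: A) = 1%:M.
Proof. by rewrite expmE expq0 mulmx0 addr0. Qed.

Lemma expq_comm A t : A *m expq A t = expq A t *m A.
Proof.
have l : A *m expq_trunc A t N @[N --> \oo] --> A *m expq A t.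
  by apply: cvg_mulmx; [exact: cvg_cst | exact: cvg_expq].
have r : expq_trunc A t N *m A @[N --> \oo] --> expq A t *m A.
  by apply: cvg_mulmx; [exact: cvg_expq | exact: cvg_cst].
apply: (cvg_unique (@norm_hausdorff _ _) l).
rewrite (_ : (fun N => _) = (fun N => expq_trunc A t N *m A)) //.
apply/funext => N; rewrite /expq_trunc /series /= mulmx_sumr mulmx_suml.
apply: eq_bigr => k _; rewrite -scalemxAr -scalemxAl; congr (_ *: _).
by rewrite -mx_exprS exprSr.
Qed.

(** The defect [D N] of the identity between partial sums is the double sum over [i + j >= N]. Its
    entries are dominated by the real remainder at [M * |t|] and [M * |s|], which tends to zero. *)
Lemma expqD A t s : expq A (t + s) = expq A t + expm (t *: A) *m expq A s.
Proof.
have [M M1 AM] := expmx_entry_bound A.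
have M0 : 0 <= M by apply: le_trans M1.
pose D N := expq_trunc A t N + exp_trunc A t N *m expq_trunc A s N -
  expq_trunc A (t + s) N.
have lD : D N @[N --> \oo] --> expq A t + expm (t *: A) *m expq A s - expq A (t + s).
  apply: cvgB; last exact: cvg_expq.
  apply: cvgD; first exact: cvg_expq.
  by apply: cvg_mulmx; [exact: cvg_expm | exact: cvg_expq].
suff D0 : D N @[N --> \oo] --> (0 : 'M[C]_n).
  by apply/eqP; rewrite eq_sym -subr_eq0; apply/eqP;
    exact: (cvg_unique (@norm_hausdorff _ _) lD D0).
have DE N : D N = \sum_(0 <= i < N) \sum_(0 <= j < N | ~~ (i + j < N)%N)
    ((t ^+ i * s ^+ j.+1) / (i`!%:R * j.+1`!%:R)) *: A ^+ (i + j).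
  rewrite -trunc_expD /D; congr (_ + _ - _).
  rewrite /exp_trunc /expq_trunc /series /= mulmx_suml; apply: eq_bigr => i _.
  rewrite mulmx_sumr; apply: eq_bigr => j _.
  rewrite exprZmx -scalemxAl -scalemxAl -scalemxAr !scalerA;
    congr (_ *: _); last by rewrite exprD.
  by rewrite invfM; ring.
apply: cvg_mx => i j; rewrite mxE.
pose a := M * complex.Re `|t|; pose b := M * complex.Re `|s|.
apply: cvg0_bound (cvg_exp_remainder a b); apply: nearW => N.
rewrite DE summxE rmorph_sum /=; apply: le_trans (ler_norm_sum _ _ _) _.
apply: ler_sum => k _; rewrite summxE rmorph_sum /=.
apply: le_trans (ler_norm_sum _ _ _) _; apply: ler_sum => l _.
rewrite mxE normrM; apply: le_trans (ler_wpM2l (normr_ge0 _) (AM _ i j)) _.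
have E : `|t ^+ k * s ^+ l.+1 / (k`!%:R * l.+1`!%:R)| =
    ((complex.Re `|t| ^+ k * complex.Re `|s| ^+ l.+1 / (k`!%:R * l.+1`!%:R))%:C)%C :> C.
  rewrite !(rmorphM, rmorphXn, fmorphV, rmorph_nat) /=.
  rewrite (Re_normE (t : C^o)) (Re_normE (s : C^o)).
  by rewrite normrM normfV !normrM !normrX !normr_nat.
rewrite E -rmorphM lecR mulrAC; apply: ler_wpM2r.
  by rewrite invr_ge0 mulr_ge0.
(* The majorant carries one more factor [M] than the bound on [A ^+ (k + l)]; [1 <= M] absorbs
   it. *)
rewrite /a /b !exprMn [leRHS]mulrACA mulrC -exprD addnS; apply: ler_wpM2r.
  by rewrite mulr_ge0 // exprn_ge0 //;
    [exact: (Re_norm_ge0 (t : C^o)) | exact: (Re_norm_ge0 (s : C^o))].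
exact: ler_weXn2l.
Qed.

(** Multiply [expqD] by [A] and add the identity; as [A] commutes with [e^{tA}], the factor [e^{tA}]
    comes out on the left. *)
Lemma expmD A t s : expm ((t + s) *: A) = expm (t *: A) *m expm (s *: A).
Proof.
have e_comm : A *m expm (t *: A) = expm (t *: A) *m A.
  by rewrite expmE mulmxDr mulmxDl mulmx1 mul1mx -[in RHS]mulmxA -expq_comm.
rewrite expmE expqD mulmxDr addrA -expmE mulmxA e_comm -mulmxA.
by rewrite -[X in X + _]mulmx1 -mulmxDr -expmE.
Qed.

End MatrixExponentialAddition.

(** * The derivative of the quotient series, and invariant subspaces *)

Section MatrixExponentialDerivative.
Variables (R : realType) (n : nat).
Local Notation C := (cplx R).
Implicit Types (A : 'M[C]_n) (t s : C).

(** Past the term [h], every term has a power of [h] of exponent at least two, which is at most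
    [|h| ^+ 2] in modulus when [|h| <= 1]; the remaining coefficients sum to at most [e^M]. *)
Lemma expq_small A : exists K : R, forall h : C, complex.Re `|h| <= 1 ->
  forall i j, `|(expq A h - h%:M) i j| <= (((complex.Re `|h| ^+ 2 * K)%:C)%C : C).
Proof.
have [M M1 AM] := expq_term_bound A.
exists (expR M) => h h1 i j; set x := complex.Re `|h| in h1 *.
have x0 : 0 <= x := Re_norm_ge0 (h : C^o).
have M0 : 0 <= M by apply: le_trans M1.
have l : (expq_trunc A h N.+1 - h%:M) i j @[N --> \oo] --> (expq A h - h%:M) i j.
  apply: cvg_mx_entry; apply: cvgB; last exact: cvg_cst.
  by rewrite (cvg_shiftS (expq_trunc A h)); exact: cvg_expq.
have l' : complex.Re `|(expq_trunc A h N.+1 - h%:M) i j| @[N --> \oo] -->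
    complex.Re `|(expq A h - h%:M) i j|.
  exact: (@continuous_cvg nat C R _ _ (fun N => (expq_trunc A h N.+1 - h%:M) i j)
    (fun z : C => complex.Re `|z|) _ (@Re_norm_continuous R C _) l).
rewrite (norm_le_real (_ : C^o)); apply: (cvgr_to_le l').
apply: nearW => N; rewrite -(norm_le_real (_ : C^o)).
have -> : expq_trunc A h N.+1 - h%:M =
    \sum_(0 <= k < N) (h ^+ k.+2 / (k.+2)`!%:R) *: A ^+ k.+1.
  rewrite /expq_trunc /series /= big_nat_recl // expr1 (_ : (1`! = 1)%N) // divr1 expr0.
  by rewrite -scalemx1 addrAC subrr add0r.
rewrite summxE; apply: le_trans (ler_norm_sum _ _ _) _.
have step k : `|((h ^+ k.+2 / (k.+2)`!%:R) *: A ^+ k.+1) i j| <=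
    (((x ^+ 2 * exp_coeff M k.+2)%:C)%C : C).
  apply: le_trans (AM _ _ _ _) _; rewrite lecR /exp_coeff /= mulrA.
  apply: ler_wpM2r; first by rewrite invr_ge0.
  rewrite exprMn mulrC; apply: ler_wpM2r; first exact: exprn_ge0.
  by rewrite ler_wiXn2l.
apply: le_trans (ler_sum _ (fun k _ => step k)) _.
rewrite -rmorph_sum lecR -mulr_sumr; apply: ler_wpM2l; first exact: exprn_ge0.
apply: le_trans (_ : series (exp_coeff M) N.+2 <= _).
  rewrite /series /= big_nat_recl // big_nat_recl // addrA lerDr.
  by rewrite addr_ge0 // exp_coeff_ge0.
apply: nondecreasing_cvgn_le; last exact: is_cvg_series_exp_coeff.
by apply: nondecreasing_series => k * ; exact: exp_coeff_ge0.
Qed.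

Lemma cvg_expq_quotient A : h^-1 *: expq A h @[h --> (0 : C)^'] --> (1%:M : 'M[C]_n).
Proof.
have [K HK] := expq_small A.
have lim0 : h^-1 *: (expq A h - h%:M) @[h --> (0 : C)^'] --> (0 : 'M[C]_n).
  apply: cvg_mx => i j; rewrite [in X in _ --> X]mxE.
  apply: (@cvg0_bound _ _ _ _ _ (fun h : C => complex.Re `|h| * K)).
    near=> h.
    have h0 : h != 0 by near: h; exact: nbhs_dnbhs_neq.
    have h1 : complex.Re `|h| <= 1.
      rewrite -(norm_le_real (h : C^o)); near: h.
      apply: dnbhs0_le. by rewrite ltcR.
    rewrite mxE normrM normfV; apply: le_trans (ler_wpM2l _ (HK h h1 i j)) _.
      by rewrite invr_ge0.
    rewrite -(Re_normE (h : C^o)) -fmorphV -rmorphM lecR mulrA.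
    by rewrite expr2 mulrA mulVf ?mul1r // -(fmorph_eq0 (real_complex R)) /=
      (Re_normE (h : C^o)) normr_eq0.
  apply: cvg_within_filter.
  have := @cvgM R _ (nbhs (0 : C)) _ _ _ _ _ (@cvg_Re_norm0 R C) (cvg_cst K).
  by rewrite (mul0r K); apply; exact: nbhs_filter.
rewrite -[X in _ --> X]add0r.
apply: cvg_trans (cvgD lim0 (cvg_cst (1%:M : 'M[C]_n))).
apply: near_eq_cvg; near=> h.
have h0 : h != 0 by near: h; exact: nbhs_dnbhs_neq.
by rewrite fctE scalerBr scale_scalar_mx mulVf // subrK.
Unshelve. all: by end_near. Qed.

(** By [expqD] the difference quotient at [t] is [e^{tA}] times the one at zero, whose limit is the
    identity. *)
Lemma is_derive_expq A m (v : 'M[C]_(n, m)) t :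
  is_derive (t : C^o) 1 (fun t : C^o => expq A t *m v) (expm (t *: A) *m v).
Proof.
have l : h^-1 *: (((fun t : C^o => expq A t *m v) \o shift (t : C^o)) (h *: (1 : C^o)) -
    expq A t *m v) @[h --> (0 : C)^'] --> expm (t *: A) *m v.
  have L : expm (t *: A) *m (h^-1 *: expq A h) *m v @[h --> (0 : C)^'] -->
      expm (t *: A) *m 1%:M *m v.
    apply: cvg_mulmx; last exact: cvg_cst.
    by apply: cvg_mulmx; [exact: cvg_cst | exact: cvg_expq_quotient].
  rewrite mulmx1 in L; rewrite [X in X @ _](_ : _ =
    (fun h : C => expm (t *: A) *m (h^-1 *: expq A h) *m v)) //.
  apply/funext => h /=.
  rewrite -mulmxBl [h *: 1]mulr1 [h + t]addrC expqD addrAC subrr add0r.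
  by rewrite -scalemxAr -scalemxAl.
apply: DeriveDef; first by apply/cvg_ex; exists (expm (t *: A) *m v).
by apply/cvg_lim; first exact: norm_hausdorff.
Qed.

(** The partial sums applied to [w] stay in [W]. So does their limit, because the projection onto
    [W] is continuous and fixes each of them. *)
Lemma expm_invariant A (W : {vspace 'cV[C]_n}) t :
  {in W, forall w, A *m w \in W} -> {in W, forall w, expm (t *: A) *m w \in W}.
Proof.
move=> AW w wW.
have u_cvg : exp_trunc A t N *m w @[N --> \oo] --> expm (t *: A) *m w.
  by apply: cvg_mulmx; [exact: cvg_expm | exact: cvg_cst].
have powW k : A ^+ k *m w \in W.
  elim: k => [|k IH]; first by rewrite expr0 mul1mx.
  by rewrite mx_exprS -mulmxA AW.
have uW N : exp_trunc A t N *m w \in W.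
  rewrite /exp_trunc /series /= mulmx_suml; apply: rpred_sum => k _.
  by rewrite exprZmx -!scalemxAl !rpredZ.
have pu : projv W (exp_trunc A t N *m w) @[N --> \oo] --> projv W (expm (t *: A) *m w).
  exact: (@continuous_cvg nat 'cV[C]_n 'cV[C]_n _ _ (fun N => exp_trunc A t N *m w)
    (projv W) _ (@linear_mx_continuous C n 1 'cV[C]_n (projv W) _) u_cvg).
have E : (fun N => projv W (exp_trunc A t N *m w)) = (fun N => exp_trunc A t N *m w).
  by apply/funext => N; rewrite projv_id.
rewrite E in pu.
by rewrite (cvg_unique (@norm_hausdorff _ _) u_cvg pu) memv_proj.
Qed.

End MatrixExponentialDerivative.

(** * Maps with zero differential and local surjectivity *)

Section RealNorm.
Variable R : realType.
Local Notation C := (cplx R).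

(** The norm over the complex field is complex-valued; this is the same number as a real, for use
    with the real order and the extreme value theorem. *)
Definition rnorm (U : normedModType C) (u : U) : R := complex.Re `|u|.

Section Theory.
Variable U : normedModType C.
Implicit Types u v : U.

Lemma rnormE u : (((rnorm u)%:C)%C : C) = `|u|.
Proof. exact: Re_normE. Qed.

Lemma rnorm_ge0 u : 0 <= rnorm u.
Proof. exact: Re_norm_ge0. Qed.

Lemma ler_rnormD u v : rnorm (u + v) <= rnorm u + rnorm v.
Proof. by rewrite -lecR rmorphD /= !rnormE ler_normD. Qed.

Lemma rnormN u : rnorm (- u) = rnorm u.
Proof. by rewrite /rnorm normrN. Qed.

Lemma rnormZ (s : R) u : rnorm (((s%:C)%C : C) *: u) = `|s| * rnorm u.
Proof. by apply: (@complexI R); rewrite rnormE normrZ norm_real_complex rmorphM /= rnormE. Qed.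

Lemma rnorm_eq0 u : (rnorm u == 0) = (u == 0).
Proof. by rewrite -(fmorph_eq0 (real_complex R)) /= rnormE normr_eq0. Qed.

Lemma rnorm0 : rnorm (0 : U) = 0.
Proof. by apply/eqP; rewrite rnorm_eq0. Qed.

Lemma nbhs_rnormP u (P : set U) :
  nbhs u P <-> exists2 r : R, 0 < r & forall v, rnorm (v - u) < r -> P v.
Proof.
split=> [/nbhs_normP[e e0 eP]|[r r0 rP]].
  have eE : ((complex.Re e)%:C)%C = e by rewrite RRe_real // gtr0_real.
  exists (complex.Re e); first by rewrite -ltcR eE.
  by move=> v vu; apply: eP; rewrite /ball_ /= distrC -rnormE -eE ltcR.
apply/nbhs_normP; exists ((r%:C)%C : C); first by rewrite /= ltcR.
by move=> v; rewrite /ball_ /= distrC -rnormE ltcR => /rP.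
Qed.

End Theory.

Lemma diff_estimate (U W : normedModType C) (F : U -> W) x : differentiable F x ->
  forall e : R, 0 < e -> exists2 r : R, 0 < r & forall h, rnorm h < r ->
    rnorm (F (x + h) - F x - 'd F x h) <= e * rnorm h.
Proof.
move=> /diff_locallyP[_] /eqaddoP H e e0.
have ec0 : 0 < ((e%:C)%C : C) by rewrite ltcR.
have /nbhs_rnormP[r r0 Hr] := H _ ec0.
exists r => // h hr; rewrite -lecR rmorphM /= !rnormE.
have := Hr h; rewrite subr0 => /(_ hr).
by rewrite /= !fctE /= [h + x]addrC opprD addrA.
Qed.

(** Restricts a complex difference quotient to real increments. *)
Lemma real_complex_dnbhs0 : (fun x : R => (x%:C)%C : C) @ 0^' --> (0 : C)^'.
Proof.
move=> P P0; have H := @real_complex_continuous R 0 _ P0.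
change (nbhs (0 : R) (fun x : R => x != 0 -> P ((x%:C)%C : C))).
change (nbhs (0 : R) (fun x : R => ((x%:C)%C : C) != 0 -> P ((x%:C)%C : C))) in H.
by apply: (@filterS _ (nbhs (0 : R)) _ _ _ _ H) => x Hx x0; apply: Hx; rewrite fmorph_eq0.
Qed.

(** [g] stands for the real or the imaginary part. Along the segment, [g \o G] is a real function
    with zero derivative, and the mean value theorem applies. *)
Lemma zero_diff_segment (U : normedModType C) (G : U -> C^o) (z0 z : U)
    (g : C -> R) : continuous g -> {morph g : x y / x - y} ->
    (forall (s : R) w, g ((s%:C)%C * w) = s * g w) ->
  (forall s : R, 0 <= s <= 1 -> let w := z0 + (s%:C)%C *: (z - z0) in
     differentiable G w /\ 'd G w (z - z0) = 0) ->
  g (G z) = g (G z0).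
Proof.
move=> gc gB gZ H.
pose u (s : R) : R := g (G (z0 + (s%:C)%C *: (z - z0))).
have g0 : g 0 = 0 by rewrite -(subrr 0) gB subrr.
have du (s : R) : 0 <= s <= 1 -> is_derive s 1 u 0.
  move=> /H[/= dG d0]; set w := z0 + _ in dG d0.
  have D0 : 'D_(z - z0) G w = 0 by rewrite deriveE.
  have l : (fun c : C => c^-1 *: (G (c *: (z - z0) + w) - G w)) @ (0 : C)^' --> 'D_(z - z0) G w.
    exact: (@diff_derivable C U C^o G w (z - z0) dG).
  rewrite D0 in l.
  have l2 : h^-1 *: ((u \o shift s) (h *: (1 : R)) - u s) @[h --> (0 : R)^'] --> (0 : R).
    have lg : g ((c^-1 : C) * (G (c *: (z - z0) + w) - G w)) @[c --> (0 : C)^'] --> (0 : R).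
      rewrite -g0.
      exact: (@continuous_cvg C C R _ _ (fun c : C => (c^-1 : C) * (G (c *: (z - z0) + w) - G w))
        g 0 (gc 0) l).
    rewrite [X in X @ _](_ : _ = (fun c : C => g ((c^-1 : C) * (G (c *: (z - z0) + w) - G w)))
      \o (fun x : R => (x%:C)%C : C)); first exact: (cvg_comp _ _ real_complex_dnbhs0 lg).
    apply/funext => h /=; apply/esym.
    rewrite -fmorphV gZ gB; congr (_ *: (g (G _) - g (G _))) => //.
    by rewrite [h *: 1]mulr1 rmorphD scalerDl /w addrCA.
  apply: DeriveDef; first by apply/cvg_ex; exists 0.
  by apply/cvg_lim; first exact: norm_hausdorff.
have [||c _] := @MVT_segment R u (fun=> 0) 0 1 ler01.
- by move=> s; rewrite in_itv /= => /andP[s0 s1]; apply: du; rewrite !ltW.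
- apply: derivable_within_continuous => s; rewrite in_itv /= => s01.
  by have [] := du s s01.
rewrite mul0r /u scale1r scale0r addr0 [z0 + _]addrC subrK => /eqP.
by rewrite subr_eq0 => /eqP.
Qed.

Lemma zero_diff_const (U : normedModType C) (G : U -> C^o) (z0 z : U) :
  (forall s : R, 0 <= s <= 1 -> let w := z0 + (s%:C)%C *: (z - z0) in
     differentiable G w /\ 'd G w (z - z0) = 0) ->
  G z = G z0.
Proof.
move=> H; apply/eqP; rewrite eq_complex; apply/andP; split; apply/eqP.
  apply: (zero_diff_segment (@Re_continuous R) _ _ H).
    by case=> [a b] [c d].
  by move=> s [a b] /=; rewrite mul0r subr0.
apply: (zero_diff_segment (@Im_continuous R) _ _ H).
  by case=> [a b] [c d].
by move=> s [a b] /=; rewrite mul0r addr0.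
Qed.

Lemma compact_closed_rball k (z0 : 'rV[C]_k) (r : R) :
  compact [set z : 'rV[C]_k | rnorm (z - z0) <= r].
Proof.
rewrite (_ : [set z | _] = [set z : 'rV[C]_k | `|z - z0| <= ((r%:C)%C : C)]).
  exact: compact_closed_ball_rV.
by apply/seteqP; split=> z /=; rewrite norm_le_real.
Qed.

(* Minimise [|F z - y|] over a small closed ball: the minimum is interior, and at
   an interior point where the value is positive it could be decreased by moving
   in a direction [v] with ['d F z v = y - F z].  No continuity of ['d F] is needed. *)
Lemma locally_onto k (E : normedModType C) (F : 'rV[C]_k -> E) (L : set E)
    (D : set 'rV[C]_k) (z0 : 'rV[C]_k) (kappa : R) :
  nbhs z0 D -> 0 < kappa ->
  (forall z, D z -> differentiable F z) ->
  (forall z, D z -> forall y, L y -> exists v, 'd F z v = y - F z) ->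
  (forall v, kappa * rnorm v <= rnorm ('d F z0 v)) ->
  exists2 delta : R, 0 < delta & forall y, L y -> rnorm (y - F z0) < delta ->
    exists2 z, D z & F z = y.
Proof.
move=> /nbhs_rnormP[r1 r10 Dr1] kappa0 dF onto low.
have D0 : D z0 by apply: Dr1; rewrite subrr rnorm0.
have k20 : 0 < kappa / 2 by rewrite divr_gt0.
have [r2 r20 est] := diff_estimate (dF _ D0) k20.
pose r := Num.min r1 r2 / 2.
have r0 : 0 < r by rewrite divr_gt0 // lt_min r10.
have rm : r < Num.min r1 r2.
  by rewrite ltr_pdivrMr // ltr_pMr ?ltr1n // lt_min r10.
have rr1 : r < r1 by apply: lt_le_trans rm _; rewrite ge_min lexx.
have rr2 : r < r2 by apply: lt_le_trans rm _; rewrite ge_min lexx orbT.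
pose B := [set z : 'rV[C]_k | rnorm (z - z0) <= r].
have BD z : B z -> D z by move=> Bz; apply: Dr1; apply: le_lt_trans rr1.
(* On [B] the error of the linear approximation uses up at most half of the lower bound [kappa]. *)
have expand z : B z -> kappa / 2 * rnorm (z - z0) <= rnorm (F z - F z0).
  move=> Bz; have := est (z - z0) (le_lt_trans Bz rr2).
  rewrite subrKC => e; have := low (z - z0).
  have := ler_rnormD (F z - F z0) (- (F z - F z0 - 'd F z0 (z - z0))).
  rewrite rnormN opprB subrKC => a b.
  lra.
exists (kappa * r / 4) => [|y Ly yd]; first by rewrite divr_gt0 // mulr_gt0.
pose f z := rnorm (F z - y).
have [|||c] := @compact_EVT_min _ R f B.
- by exists z0; rewrite /B /= subrr rnorm0 ltW.
- exact: compact_closed_rball.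
- apply: continuous_in_subspaceT => z; rewrite inE => Bz.
  apply: (@continuous_comp _ E R F (fun u => rnorm (u - y))).
    by apply: differentiable_continuous; apply: dF; apply: BD.
  exact: Re_normB_continuous.
rewrite inE => Bc fmin.
have fc : f c < kappa * r / 4.
  apply: le_lt_trans (fmin z0 _) _; first by rewrite inE /B /= subrr rnorm0 ltW.
  by rewrite /f -rnormN opprB.
(* The minimiser is interior: on the sphere [F] is at distance at least [kappa * r / 2] from [F z0],
   whereas [F c] and [F z0] are both within [kappa * r / 4] of [y]. *)
have cr : rnorm (c - z0) < r.
  rewrite lt_neqAle Bc andbT; apply/eqP => cr.
  have := expand c Bc; rewrite cr => e1.
  have := ler_rnormD (F c - y) (y - F z0); rewrite addrA subrK => e2.
  rewrite /f in fc; lra.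
have [m0|m0] := eqVneq (f c) 0.
  by exists c; [exact: BD | apply/eqP; rewrite -subr_eq0 -rnorm_eq0; apply/eqP].
have {m0}m0 : 0 < f c by rewrite lt_neqAle eq_sym m0 rnorm_ge0.
have [v dv] := onto c (BD c Bc) y Ly.
(* With this [eps] the error [eps * (s * rnorm v)] stays below the first-order gain [s * f c]. The
   added one keeps the denominator positive when [v = 0]. *)
pose eps := f c / (2 * (rnorm v + 1)).
have v1 : 0 < rnorm v + 1 by rewrite ltr_wpDl // rnorm_ge0.
have eps0 : 0 < eps by rewrite divr_gt0 // mulr_gt0.
have [rho rho0 est2] := diff_estimate (dF _ (BD c Bc)) eps0.
pose q := Num.min rho (r - rnorm (c - z0)).
have q0 : 0 < q by rewrite lt_min rho0 subr_gt0.
(* The step is short enough to remain in [B] and within the range of the estimate at [c]; [s <= 1]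
   keeps the factor [1 - s] nonnegative. *)
pose s := Num.min 1 (q / (2 * (rnorm v + 1))).
have s0 : 0 < s by rewrite lt_min ltr01 divr_gt0 // mulr_gt0.
have s1 : s <= 1 by rewrite ge_min lexx.
have sv : s * rnorm v < q.
  have h1 : s <= q / (2 * (rnorm v + 1)) by rewrite ge_min lexx orbT.
  have h2 : s * (rnorm v + 1) <= q / 2.
    rewrite -ler_pdivlMr //; apply: le_trans h1 _.
    by rewrite invfM mulrA.
  lra.
pose w := c + ((s%:C)%C : C) *: v.
have nsv : rnorm (((s%:C)%C : C) *: v) = s * rnorm v by rewrite rnormZ gtr0_norm.
have Bw : B w.
  rewrite /B /= /w addrAC; apply: le_trans (ler_rnormD _ _) _; rewrite nsv.
  have : q <= r - rnorm (c - z0) by rewrite ge_min lexx orbT.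
  by move=> ?; lra.
have := est2 (((s%:C)%C : C) *: v); rewrite nsv => e1.
have {}e1 := e1 (lt_le_trans sv (_ : q <= rho)).
have : f c <= f w by apply: fmin; rewrite inE.
have fw : f w <= (1 - s) * f c + eps * (s * rnorm v).
  rewrite /f (_ : F w - y = ((1 - s)%:C)%C *: (F c - y) +
      (F w - F c - 'd F c (((s%:C)%C : C) *: v))).
    apply: le_trans (ler_rnormD _ _) _; rewrite rnormZ ger0_norm ?subr_ge0 //.
    apply: lerD => //; apply: e1; by rewrite ge_min lexx.
  rewrite linearZ /= dv rmorphB rmorph1 scalerBl scale1r.
  rewrite -[y - F c]opprB scalerN opprK.
  by rewrite addrACA addNr addr0 [RHS]addrC addrA subrK.
have ev : eps * (s * rnorm v) < s * f c.
  rewrite mulrCA ltr_pM2l // /eps mulrAC ltr_pdivrMr ?mulr_gt0 // ltr_pM2l //.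
  by have := rnorm_ge0 v; lra.
by move=> ?; lra.
Qed.

End RealNorm.

(** * Continuity and lower bounds for linear maps in finite dimension *)

Section LinearMaps.
Variable K : numFieldType.

Definition pair_inl m n (B : 'M[K]_(m, n)) : 'M[K]_(m, n) * K^o := (B, 0).

Fact pair_inl_linear m n : linear (@pair_inl m n).
Proof. by move=> a B D; congr (_, _); rewrite /= scaler0 addr0. Qed.
HB.instance Definition _ m n :=
  GRing.isLinear.Build K _ _ _ (@pair_inl m n) (@pair_inl_linear m n).

(** Reduced to matrices by [f (B, t) = f (B, 0) + t *: f (0, 1)]. *)
Lemma linear_prod_continuous m n (V : normedModType K)
  (f : {linear ('M[K]_(m, n) * K^o)%type -> V}) : continuous f.
Proof.
have E x : f x = f (pair_inl x.1) + x.2 *: f (0, 1).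
  rewrite -linearZ -linearD; congr (f _); case: x => B t /=.
  by congr (_, _); rewrite /= ?scaler0 ?addr0 // add0r [RHS]mulr1.
have -> : (f : _ -> _) = (fun x => (f \o @pair_inl m n) x.1 + x.2 *: f (0, 1)).
  by apply/funext => x; exact: E.
move=> x; apply: (@cvgD _ _ _ (nbhs x)).
  apply: (@continuous_comp _ 'M[K]_(m, n) V fst (f \o @pair_inl m n)).
    exact: cvg_fst.
  exact: linear_mx_continuous.
apply: (@continuous_comp _ K^o V snd ( *:%R^~ (f (0, 1)))).
  exact: cvg_snd.
exact: scalel_continuous.
Qed.

End LinearMaps.

(** An injective linear map has a linear left inverse, which is continuous and so Lipschitz; [kappa]
    is the inverse of its Lipschitz constant. *)
Lemma injective_linear_lower_bound (R : realType) k m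
    (f : {linear 'rV[cplx R]_k -> ('cV[cplx R]_m * (cplx R)^o)%type}) :
  injective f ->
  exists2 kappa : R, 0 < kappa & forall v, kappa * rnorm v <= rnorm (f v).
Proof.
move=> fI; pose h := linfun f.
have h0 : lker h == 0%VS.
  apply/eqP/vspaceP => v; rewrite memv_ker memv0 lfunE /=.
  by apply/eqP/eqP => [|->]; [rewrite -(linear0 f) => /fI | rewrite linear0].
have [M M0 HM] := linear_lipschitz (@linear_prod_continuous (cplx R) m 1 'rV[cplx R]_k (h^-1)%VF).
have ME : ((complex.Re M)%:C)%C = M by rewrite RRe_real // gtr0_real.
have M0' : 0 < complex.Re M by rewrite -ltcR ME.
exists (complex.Re M)^-1; first by rewrite invr_gt0.
move=> v; rewrite mulrC ler_pdivrMr // mulrC -lecR rmorphM /= ME !rnormE.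
have := lker0_lfunK h0 v; rewrite lfunE /= => E;
  by have := HM (f v); rewrite [X in `|X| <= _](_ : _ = v) //; exact: E.
Qed.

(** * Functions with zero differential on a connected Lie group *)

Section ConnectedLieGroup.
Variable R : realType.
Local Notation C := (cplx R).

Lemma ch_fun_continuous (T : topologicalType) k (c : chart R T k) x :
  ch_dom c x -> {for x, continuous c}.
Proof.
move=> cx; have := @ch_fun_cont _ _ _ c.
by rewrite (continuous_open_subspace _ (@ch_dom_open _ _ _ c)); apply; rewrite inE.
Qed.

Lemma ch_inv_continuous (T : topologicalType) k (c : chart R T k) z :
  ch_cod c z -> {for z, continuous (ch_inv c)}.
Proof.
move=> cz; have := @ch_inv_cont _ _ _ c.
by rewrite (continuous_open_subspace _ (@ch_cod_open _ _ _ c)); apply; rewrite inE.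
Qed.

(** On a ball inside a chart [zero_diff_const] applies, so [g] is locally constant; its level sets
    are then open and closed. *)
Lemma connected_const (G : complexLieGroup R) (g : G -> C^o) :
  connected [set: G] ->
  (forall c, lg_atlas c -> forall z, ch_cod c z ->
     differentiable (g \o ch_inv c) z /\ forall v, 'd (g \o ch_inv c) z v = 0) ->
  forall x y, g x = g y.
Proof.
move=> conn dg x y.
have loc w : nbhs w [set u | g u = g w].
  have [c ac cw] := lg_cover w.
  have zc := ch_funP cw.
  have : nbhs (c w) (ch_cod c) by apply: open_nbhs_nbhs; split=> //; exact: ch_cod_open.
  move=> /nbhs_rnormP[r r0 Hr].
  have Nc : nbhs w (ch_dom c) by apply: open_nbhs_nbhs; split=> //; exact: ch_dom_open.
  have Nb : nbhs w [set u | rnorm (c u - c w) < r].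
    have Bc : nbhs (c w) [set z | rnorm (z - c w) < r] by apply/nbhs_rnormP; exists r.
    exact: (ch_fun_continuous cw Bc).
  apply: filterS (filterI Nc Nb) => u [/= cu ur].
  rewrite -(ch_funK cu) -(ch_funK cw).
  apply: (@zero_diff_const R _ (g \o ch_inv c)) => s /andP[s0 s1] z.
  have zr : ch_cod c z.
    apply: Hr; rewrite /z addrAC subrr add0r rnormZ ger0_norm //.
    by apply: le_lt_trans ur; rewrite ler_piMl // rnorm_ge0.
  by have [? d0] := dg c ac z zr; split.
have op a : open [set u | g u = a].
  by rewrite openE => u /= <-; exact: loc.
suff E : [set u | g u = g y] = [set: G] by have : [set u | g u = g y] x by rewrite E.
apply: conn.
- by exists y.
- by exists [set u | g u = g y]; [exact: op | rewrite setTI].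
exists [set u | g u = g y]; last by rewrite setTI.
rewrite -[X in closed X]setCK; apply: open_closedC.
rewrite openE => u /= gu; apply: filterS (loc u) => w /= ->; exact: gu.
Qed.

Lemma connected_const_prod (G : complexLieGroup R) m (F : G -> 'cV[C]_m * C^o) :
  connected [set: G] ->
  (forall c, lg_atlas c -> forall z, ch_cod c z ->
     differentiable (F \o ch_inv c) z /\ forall v, 'd (F \o ch_inv c) z v = 0) ->
  forall x y, F x = F y.
Proof.
move=> conn dF x y.
have coord (l : 'cV[C]_m * C^o -> C^o) : (forall p, differentiable l p) ->
    l (F x) = l (F y).
  move=> dl; apply: (@connected_const G (l \o F)) => // c ac z cz.
  have [d1 d2] := dF c ac z cz.
  have dlz := dl ((F \o ch_inv c) z).
  split; first exact: (differentiable_comp d1 dlz).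
  move=> v; rewrite [X in 'd X z](_ : _ = l \o (F \o ch_inv c)) // (diff_comp d1 dlz) /=.
  by rewrite d2 linear0.
rewrite [F x]surjective_pairing [F y]surjective_pairing; congr (_, _).
  apply/matrixP => i j; apply: (coord (fun p => p.1 i j)) => p.
  apply: (@differentiable_comp _ _ _ _ fst (fun M : 'cV[C]_m => M i j : C^o)).
    by apply: linear_differentiable => q; exact: cvg_fst.
  exact: (@differentiable_coord C m 1 p.1 i j).
by apply: (coord snd) => p; apply: linear_differentiable => q; exact: cvg_snd.
Qed.

End ConnectedLieGroup.

(** * Immersed subgroups of an almost Abelian group *)

Section Tangent.
Variables (R : realType) (aleph : multiplicity R).
Local Notation C := (cplx R).
Local Notation V := ('cV[C]_(jdim aleph) * C^o)%type.
Local Notation ej t := (expm ((t : C) *: jordan aleph)).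

Local Notation amul := (@aa_mul R aleph).

(** The differential of left translation by any element with second coordinate [t]: that translation
    is affine with this linear part. *)
Definition aa_lin (t : C) (x : V) : V := (ej t *m x.1, x.2).

Fact aa_lin_linear t : linear (aa_lin t).
Proof. by move=> a x y; congr (_, _); rewrite /= mulmxDr -scalemxAr. Qed.
HB.instance Definition _ t :=
  GRing.isLinear.Build C V V _ (aa_lin t) (aa_lin_linear t).

Lemma aa_linK t : cancel (aa_lin t) (aa_lin (- t)).
Proof.
by case=> v s; congr (_, _); rewrite /= mulmxA -expmD addNr expm0 mul1mx.
Qed.

Lemma aa_lin_continuous t : continuous (aa_lin t).
Proof. exact: linear_prod_continuous. Qed.

Lemma aa_mulE x : amul x = cst x + aa_lin x.2.
Proof. by apply/funext => y. Qed.

Lemma differentiable_aa_mul x y : differentiable (amul x) y.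
Proof.
rewrite aa_mulE; apply: differentiableD => //.
by apply: linear_differentiable; exact: aa_lin_continuous.
Qed.

Lemma diff_aa_mul x y : 'd (amul x) y = aa_lin x.2 :> (V -> V).
Proof.
have dl := linear_differentiable y (@aa_lin_continuous x.2).
have E := @diffD C V V (cst x) (aa_lin x.2) y (differentiable_cst x y) dl.
rewrite aa_mulE; rewrite E.
have E0 : ('d (cst x) y : V -> V) = 0 := @diff_cst C V V x y.
have E1 : ('d (aa_lin x.2) y : V -> V) = aa_lin x.2 :=
  @diff_lin C V V _ y (@aa_lin_continuous x.2).
by apply: etrans (congr2 (fun f g : V -> V => f + g) E0 E1) _; apply/funext => v; exact: add0r.
Qed.

Variable H : lie_subgroup aleph.
Local Notation iota := (ls_incl H).

(** The image of the unit is idempotent for [aa_mul]: first [t + t = t] gives [t = 0], then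
    [v + v = v]. *)
Lemma ls_incl1 : iota 1%g = 0.
Proof.
have := ls_mul (1%g : H) 1%g; rewrite mulg1; case: (iota 1%g) => v t [].
rewrite /aa_mul /= => E1 E2.
have t0 : t = 0 by apply: (addrI t); rewrite -E2 addr0.
move: E1; rewrite t0 expm0 mul1mx => E1.
have v0 : v = 0 by apply: (addrI v); rewrite -E1 addr0.
by rewrite v0.
Qed.

Lemma ls_inclV_snd h : (iota h^-1%g).2 = - (iota h).2.
Proof.
have := ls_mul h^-1%g h; rewrite mulVg ls_incl1 => /(congr1 snd) /= /esym E.
by apply/eqP; rewrite -addr_eq0; apply/eqP.
Qed.

(* Differentiate [iota (h * y) = aa_mul (iota h) (iota y)] at [y = x]. *)
Lemma tangent_translate (h x : H) c c' (v : 'rV[C]_(lg_dim H)) :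
  lg_atlas c -> lg_atlas c' -> ch_dom c x -> ch_dom c' (h * x)%g ->
  exists u, 'd (iota \o ch_inv c') (c' (h * x)%g) u =
    aa_lin (iota h).2 ('d (iota \o ch_inv c) (c x) v).
Proof.
move=> ac ac' cx c'hx.
have [ch ach chh] := lg_cover h.
have zc := ch_funP cx; have zh := ch_funP chh.
pose m (z : 'rV[C]_(lg_dim H)) := c' (h * ch_inv c z)%g.
(* Left translation by [h] in charts is the multiplication with its first argument frozen at
   [ch h]. *)
have dm : differentiable m (c x).
  have dp : differentiable (fun z : 'rV[C]_(lg_dim H) => (ch h, z)) (c x).
    by apply: differentiable_pair.
  have := @lg_mul_holo _ H ch c c' ach ac ac' (ch h) (c x) zh zc.
  rewrite (ch_funK chh) (ch_funK cx) => /(_ c'hx) dh.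
  have := differentiable_comp dp dh.
  congr (differentiable _ _); apply/funext => z.
  by rewrite /m /= (ch_funK chh).
have mx : m (c x) = c' (h * x)%g by rewrite /m (ch_funK cx).
(* The identity holds only near [c x], where the product stays in the domain of [c']; this suffices
   for derivatives. *)
have nearE : \forall z \near c x, (iota \o ch_inv c') (m z) = amul (iota h) ((iota \o ch_inv c) z).
  have Nd : nbhs (h * ch_inv c (c x))%g (ch_dom c').
    by rewrite (ch_funK cx); apply: open_nbhs_nbhs; split=> //; exact: (@ch_dom_open _ _ _ c').
  have cont : {for c x, continuous (fun z => (h * ch_inv c z)%g)}.
    apply: (@continuous_comp _ (H * H)%type H (fun z => (h, ch_inv c z)) (fun p => (p.1 * p.2)%g)).
      by apply: (@cvg_pair _ _ _ (nbhs (c x))); [exact: cvg_cst | exact: ch_inv_continuous].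
    exact: lg_mul_cont.
  apply: (@filterS _ (nbhs (c x)) _ _ _ _ (cont _ Nd)) => z /= hz.
  by rewrite /m (ch_funK hz) ls_mul.
have dc' : differentiable (iota \o ch_inv c') (m (c x)).
  by apply: ls_holo => //; rewrite mx; exact: ch_funP.
have dc : differentiable (iota \o ch_inv c) (c x) by exact: ls_holo.
exists ('d m (c x) v).
have da := @differentiable_aa_mul (iota h) ((iota \o ch_inv c) (c x)).
have E1 : 'D_v ((iota \o ch_inv c') \o m) (c x) =
    'd (iota \o ch_inv c') (m (c x)) ('d m (c x) v).
  exact: etrans (deriveE v (differentiable_comp dm dc'))
    (congr1 (fun f : 'rV[C]_(lg_dim H) -> V => f v) (diff_comp dm dc')).
have E2 : 'D_v (amul (iota h) \o (iota \o ch_inv c)) (c x) =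
    'd (amul (iota h)) ((iota \o ch_inv c) (c x)) ('d (iota \o ch_inv c) (c x) v).
  exact: etrans (deriveE v (differentiable_comp dc da))
    (congr1 (fun f : 'rV[C]_(lg_dim H) -> V => f v) (diff_comp dc da)).
have E3 := congr1 (fun f : V -> V => f ('d (iota \o ch_inv c) (c x) v))
  (diff_aa_mul (iota h) ((iota \o ch_inv c) (c x))).
rewrite -mx; exact: etrans (esym E1) (etrans (near_eq_derive v nearE) (etrans E2 E3)).
Qed.

Variable L : {vspace V}.
Hypothesis HL : has_lie_algebra H L.

(** Translation by [h^-1] carries the tangent space at [h] into [L], and translation by [h] carries
    [L] back: one inclusion each. *)
Lemma tangent_range (h : H) c : lg_atlas c -> ch_dom c h ->
  range ('d (iota \o ch_inv c) (c h)) = aa_lin (iota h).2 @` [set x | x \in L].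
Proof.
move=> ac ch; have [c1 ac1 c11] := lg_cover (1%g : H).
have HL1 := HL ac1 c11.
apply/seteqP; split=> [_ [v _ <-]|_ [x xL <-]].
  have hh : ch_dom c1 (h^-1 * h)%g by rewrite mulVg.
  have [u] := tangent_translate v ac ac1 ch hh.
  rewrite mulVg ls_inclV_snd => E.
  exists (aa_lin (- (iota h).2) ('d (iota \o ch_inv c) (c h) v)).
    by rewrite -E -[X in X _]HL1; exists u.
  by rewrite -{1}[(iota h).2]opprK aa_linK.
have : [set x | x \in L] x by [].
rewrite -HL1 => -[v _ <-].
have hh : ch_dom c (h * 1)%g by rewrite mulg1.
have [u] := tangent_translate v ac1 ac c11 hh.
by rewrite mulg1 => <-; exists u.
Qed.

End Tangent.

(** * The straightening map and its differential *)

Section Straighten.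
Variables (R : realType) (aleph : multiplicity R).
Local Notation C := (cplx R).
Local Notation V := ('cV[C]_(jdim aleph) * C^o)%type.
Local Notation ej t := (expm ((t : C) *: jordan aleph)).
Variables (v0 v1 : 'cV[C]_(jdim aleph)).

(* Sends the one-parameter subgroup through [(v0, 1)] to the line through [(v1, 1)]. *)
Definition straighten (x : V) : V :=
  (x.1 - expm_quo aleph x.2 *m v0 + (x.2 : C) *: v1, x.2).

Lemma straighten_inj : injective straighten.
Proof. by move=> [v t] [w s] [+ ts]; rewrite ts => /addIr /addIr ->. Qed.

(** The linear summand of [straighten]. *)
Definition shear (x : V) : V := (x.1 + (x.2 : C) *: v1, x.2).

Fact shear_linear : linear shear.
Proof.
move=> a x y; congr (_, _); rewrite /= scalerDr scalerDl scalerA addrACA.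
by congr (_ + _).
Qed.
HB.instance Definition _ := GRing.isLinear.Build C V V _ shear shear_linear.

Lemma is_diff_linear (U W : normedModType C) (f : {linear U -> W}) x :
  continuous f -> is_diff x f f.
Proof. by move=> fc; apply: DiffDef; [exact: linear_differentiable | exact: diff_lin]. Qed.

(** The differential of [straighten] at [x], applied to [y]; the exponential is the derivative of
    the quotient series. *)
Definition dstraighten (x y : V) : V :=
  (y.1 - (y.2 : C) *: (ej x.2 *m v0) + (y.2 : C) *: v1, y.2).

Lemma dstraighten_inj x : injective (dstraighten x).
Proof. by move=> [v t] [w s] [+ ts]; rewrite /= ts => /addIr /addIr ->. Qed.

Lemma is_diff_straighten x : is_diff x straighten (dstraighten x).
Proof.
have dq : is_derive (x.2 : C^o) 1 (fun t : C^o => expq (jordan aleph) t *m v0) (ej x.2 *m v0).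
  exact: is_derive_expq.
have dq' : differentiable (fun t : C^o => expq (jordan aleph) t *m v0) x.2.
  by apply/(@derivable1_diffP C); case: dq.
have D3 : is_diff (x.2 : C^o) (fun t : C^o => expq (jordan aleph) t *m v0)
    (fun t : C^o => (t : C) *: (ej x.2 *m v0)).
  apply: DiffDef => //; rewrite (@diff1E C _ _ x.2 dq') derive1E.
  by case: dq => _ ->.
have D1 := @is_diff_linear V V shear x (@linear_prod_continuous C _ 1 V shear).
have D2 : is_diff x snd snd.
  apply: is_diff_linear => q; exact: cvg_snd.
have D4 y := @is_diff_linear _ V (@pair_inl C _ 1) y
  (@linear_mx_continuous C _ 1 V (@pair_inl C _ 1)).
have D := @is_diffB _ _ _ _ _ _ _ _ D1 (is_diff_comp (is_diff_comp D2 D3) (D4 _)).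
have E1 : straighten = shear - (@pair_inl C _ 1 \o
    ((fun t : C^o => expq (jordan aleph) t *m v0) \o snd)).
  by apply/funext => y; congr (_, _); rewrite /= ?subr0 // addrAC.
have E2 : dstraighten x = shear - (@pair_inl C _ 1 \o
    ((fun t : C^o => (t : C) *: (ej x.2 *m v0)) \o snd)).
  by apply/funext => y; congr (_, _); rewrite /= ?subr0 // addrAC.
rewrite E1 E2; exact: D.
Qed.

End Straighten.

(** * The straightened inclusion of a connected subgroup *)

Section Range.
Variables (R : realType) (aleph : multiplicity R).
Local Notation C := (cplx R).
Local Notation V := ('cV[C]_(jdim aleph) * C^o)%type.
Local Notation ej t := (expm ((t : C) *: jordan aleph)).
Local Notation qj t := (expm_quo aleph (t : C)).

Lemma straighten0 v0 v1 : straighten v0 v1 0 = 0 :> V.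
Proof.
congr (_, _); rewrite /= scale0r addr0 [expm_quo _ _](_ : _ = 0) ?mul0mx ?subr0 //.
exact: expq0.
Qed.

Lemma straighten_mul v0 (x y : V) :
  straighten v0 0 (aa_mul x y) = aa_mul (straighten v0 0 x) (straighten v0 0 y).
Proof.
case: x y => [v t] [u s]; rewrite /straighten /aa_mul /=.
have E : qj (t + s) = qj t + ej t *m qj s := expqD (jordan aleph) t s.
apply: (congr2 pair _ (erefl (t + s))).
move: E; move: (qj t) (qj s) (qj (t + s)) (ej t) => q1 q2 q3 e1 ->.
by rewrite !scaler0 !addr0 mulmxDl opprD mulmxBr mulmxA addrACA.
Qed.

Section Incl.
Variable H : lie_subgroup aleph.
Local Notation iota := (ls_incl H).
Variables (v0 v1 : 'cV[C]_(jdim aleph)).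

Lemma is_diff_straighten_incl c z : lg_atlas c -> ch_cod c z ->
  is_diff z ((straighten v0 v1 \o iota) \o ch_inv c)
    (dstraighten v0 v1 (iota (ch_inv c z)) \o 'd (iota \o ch_inv c) z).
Proof.
move=> ac cz.
have D1 : is_diff z (iota \o ch_inv c) ('d (iota \o ch_inv c) z).
  by apply: DiffDef => //; exact: ls_holo.
exact: is_diff_comp D1 (is_diff_straighten v0 v1 _).
Qed.

Lemma differentiable_straighten_incl c z : lg_atlas c -> ch_cod c z ->
  differentiable ((straighten v0 v1 \o iota) \o ch_inv c) z.
Proof. by move=> ac cz; case: (is_diff_straighten_incl ac cz). Qed.

Lemma diff_straighten_incl c z u : lg_atlas c -> ch_cod c z ->
  'd ((straighten v0 v1 \o iota) \o ch_inv c) z u =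
  dstraighten v0 v1 (iota (ch_inv c z)) ('d (iota \o ch_inv c) z u).
Proof.
move=> ac cz; case: (is_diff_straighten_incl ac cz) => _ E.
exact: (congr1 (fun f : _ -> V => f u) E).
Qed.

Lemma straighten_incl_immersion c z : lg_atlas c -> ch_cod c z ->
  injective ('d ((straighten v0 v1 \o iota) \o ch_inv c) z).
Proof.
move=> ac cz u w E; apply: (ls_immersion ac cz).
apply: (@dstraighten_inj _ _ v0 v1 (iota (ch_inv c z))).
exact: etrans (esym (diff_straighten_incl u ac cz))
  (etrans E (diff_straighten_incl w ac cz)).
Qed.

Variable L : {vspace V}.
Hypothesis HL : has_lie_algebra H L.
Hypothesis Hconn : connected [set: H].
(** What each of the two cases has to verify: left translation by [iota h] followed by the
    differential of the straightening maps [L] onto itself. *)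
Hypothesis straight : forall h : H,
  (fun x => dstraighten v0 v1 (iota h) (aa_lin (iota h).2 x)) @` [set x | x \in L] =
  [set x | x \in L].

Lemma diff_straighten_incl_range c z : lg_atlas c -> ch_cod c z ->
  range ('d ((straighten v0 v1 \o iota) \o ch_inv c) z) = [set x | x \in L].
Proof.
move=> ac cz; have cx := ch_invP cz.
have := tangent_range HL ac cx; rewrite (ch_invK cz) => /seteqP[T1 T2].
have /seteqP[S1 S2] := straight (ch_inv c z).
apply/seteqP; split=> [_ [u _ <-]|y yL].
  have [x xL E] := T1 _ (ex_intro2 _ _ u I erefl).
  apply: S1; exists x; first exact: xL.
  exact: etrans (congr1 (dstraighten v0 v1 _) E) (esym (diff_straighten_incl u ac cz)).
have [x xL xy] := S2 _ yL.
have [u _ E] := T2 _ (ex_intro2 _ _ x xL erefl).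
exists u; first exact: I.
exact: etrans (diff_straighten_incl u ac cz) (etrans (congr1 (dstraighten v0 v1 _) E) xy).
Qed.

(** [p] is a linear map that kills [L] and whose kernel is contained in [L]. Composed with the
    straightened inclusion it has zero differential, so it keeps its value [0] at the unit. *)
Lemma straighten_incl_mem (h : H) : straighten v0 v1 (iota h) \in L.
Proof.
pose p : {linear V -> V} := (\1 - projv L)%VF.
have pc : continuous p by exact: linear_prod_continuous.
have pE x : p x = x - projv L x by rewrite /p /= add_lfunE opp_lfunE id_lfunE.
have pL x : x \in L -> p x = 0.
  by move=> xL; rewrite pE projv_id ?subrr.
have C0 := @connected_const_prod R H _ (p \o (straighten v0 v1 \o iota)) Hconn.
have /C0/(_ h 1%g) : forall c, lg_atlas c -> forall z, ch_cod c z ->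
   differentiable ((p \o (straighten v0 v1 \o iota)) \o ch_inv c) z /\
   forall v, 'd ((p \o (straighten v0 v1 \o iota)) \o ch_inv c) z v = 0.
  move=> c ac z cz.
  have dF := differentiable_straighten_incl ac cz.
  have dp := @linear_differentiable _ _ _ p (((straighten v0 v1 \o iota) \o ch_inv c) z) pc.
  split; first exact: (differentiable_comp dF dp).
  move=> v; have rL : 'd ((straighten v0 v1 \o iota) \o ch_inv c) z v \in L.
    have /seteqP[T1 _] := diff_straighten_incl_range ac cz.
    exact: (T1 _ (ex_intro2 _ _ v I erefl)).
  apply: etrans (pL _ rL).
  apply: etrans (congr1 (fun f : _ -> V => f v) (diff_comp dF dp)) _.
  exact: (congr1 (fun f : V -> V => f ('d ((straighten v0 v1 \o iota) \o ch_inv c) z v))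
    (@diff_lin C V V p (((straighten v0 v1 \o iota) \o ch_inv c) z) pc)).
rewrite /= ls_incl1 straighten0 linear0 pE => /eqP; rewrite subr_eq0 => /eqP ->.
exact: memv_proj.
Qed.

(** For [y] in [L], the vector [y - F z] lies in [L] by [straighten_incl_mem], hence in the range of
    the differential, as [locally_onto] asks; immersivity at the unit provides [kappa]. *)
Lemma straighten_incl_locally_onto : exists2 delta : R, 0 < delta &
  forall y, y \in L -> rnorm y < delta -> exists h, straighten v0 v1 (iota h) = y.
Proof.
have [c ac c1] := lg_cover (1%g : H).
have z1 := ch_funP c1.
pose F := (straighten v0 v1 \o iota) \o ch_inv c.
have [kappa k0 low] := @injective_linear_lower_bound R _ _ ('d F (c 1%g))
  (straighten_incl_immersion ac z1).
have [|||||d d0 onto] := @locally_onto R _ V F [set x | x \in L] (ch_cod c) (c 1%g) kappa.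
- by apply: open_nbhs_nbhs; split=> //; exact: (@ch_cod_open _ _ _ c).
- exact: k0.
- by move=> z cz; exact: differentiable_straighten_incl.
- move=> z cz y yL.
  have /seteqP[_ T2] := diff_straighten_incl_range ac cz.
  have yF : [set x | x \in L] (y - F z).
    by apply: rpredB; [exact: yL | exact: straighten_incl_mem].
  by have [v _ E] := T2 _ yF; exists v.
- exact: low.
exists d => // y yL yd; have [|z cz E] := onto y yL.
  by rewrite /F /= (ch_funK c1) ls_incl1 straighten0 subr0.
by exists (ch_inv c z).
Qed.

End Incl.
End Range.

(** By the Archimedean property, with [a = 1 / n]. An element over the small vector [a *: y] is then
    raised to the power [n] to reach [y]. *)
Lemma small_multiple (R : realType) (U : normedModType (cplx R)) (y : U) (delta : R) :
  0 < delta -> exists n : nat, exists2 a : cplx R, n%:R * a = 1 & rnorm (a *: y) < delta.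
Proof.
move=> d0; have y0 := rnorm_ge0 y.
pose n := Num.bound (rnorm y / delta).
have yn : rnorm y / delta < n%:R by apply: archi_boundP; rewrite divr_ge0 // ltW.
have n0 : 0 < (n%:R : R) by apply: le_lt_trans yn; rewrite divr_ge0 // ltW.
exists n; exists (((n%:R^-1)%:C)%C : cplx R).
  rewrite -(rmorph_nat (real_complex R)) -rmorphM /= mulfV ?gt_eqF //.
rewrite rnormZ gtr0_norm ?invr_gt0 // mulrC ltr_pdivrMr //.
by rewrite mulrC -ltr_pdivrMr.
Qed.

(** * Powers in the subgroup, and the exponential on the Abelian ideal *)

Section Powers.
Variables (R : realType) (aleph : multiplicity R) (H : lie_subgroup aleph).
Local Notation C := (cplx R).
Local Notation iota := (ls_incl H).
Local Notation J := (jordan aleph).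

Lemma ls_incl_pow_fst h w n : iota h = (w, 0) -> iota (h ^+ n)%g = (w *+ n, 0).
Proof.
move=> hw; elim: n => [|n IH]; first exact: ls_incl1.
by rewrite expgS ls_mul IH hw /aa_mul /= expm0 mul1mx addr0 mulrS.
Qed.

(** The points [(q(s) v0, s)] form the one-parameter subgroup through [(v0, 1)], by [expqD]; the
    power [n] multiplies the time by [n]. *)
Lemma ls_incl_pow_quo h v0 (s : C) n : iota h = (expm_quo aleph s *m v0, s) ->
  iota (h ^+ n)%g = (expm_quo aleph (s *+ n) *m v0, s *+ n).
Proof.
move=> hs; elim: n => [|n IH].
  have E : expm_quo aleph 0 = 0 := expq0 J.
  by rewrite mulr0n E mul0mx; exact: ls_incl1.
have E : expm_quo aleph (s + s *+ n) =
  expm_quo aleph s + expm (s *: J) *m expm_quo aleph (s *+ n) := expqD J s (s *+ n).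
rewrite expgS ls_mul IH hs /aa_mul /= mulrS E.
move: (expm_quo aleph s) (expm_quo aleph (s *+ n)) (expm (s *: J)) => q1 q2 e.
by rewrite mulmxDl mulmxA.
Qed.

Lemma aa_exp_fst w : aa_exp aleph (w, 0) = (w, 0).
Proof.
rewrite /aa_exp /=; set l := limn _.
suff -> : l = 1%:M by rewrite mul1mx.
apply/cvg_lim; first exact: norm_hausdorff.
rewrite -[X in X @ _ --> _]/(series _).
(* The partial sums are constant only from index one on, the empty one being zero. *)
set u := series _; rewrite -(cvg_shiftS u).
rewrite (_ : (fun N => u N.+1) = cst 1%:M); first exact: cvg_cst.
apply/funext => N; rewrite /u /series /= big_nat_recl // (_ : (1`! = 1)%N) // invr1 expr0.
rewrite scale1r big1 ?addr0 // => k _.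
by rewrite exprZmx expr0n scale0r scaler0.
Qed.

End Powers.

(** * The image of the subgroup in the two cases *)

Section Subgroups.
Variables (R : realType) (aleph : multiplicity R).
Local Notation C := (cplx R).
Local Notation V := ('cV[C]_(jdim aleph) * C^o)%type.
Local Notation J := (jordan aleph).
Variables (L : {vspace V}) (H : lie_subgroup aleph).
Hypotheses (Hconn : connected [set: H]) (HL : has_lie_algebra H L).
Local Notation iota := (ls_incl H).

(** The Abelian case uses the general results with this trivial straightening. *)
Lemma straighten00 (x : V) : straighten 0 0 x = x.
Proof.
case: x => v t; rewrite /straighten /=; move: (expm_quo aleph t) => q.
by rewrite mulmx0 subr0 scaler0 addr0.
Qed.

Lemma dstraighten00 (x y : V) : dstraighten 0 0 x y = y.
Proof.
case: y => v t; rewrite /dstraighten /=; move: (expm _) => e.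
by rewrite mulmx0 !scaler0 subr0 addr0.
Qed.

Lemma aa_lin0 (x : V) : aa_lin 0 x = x.
Proof. by case: x => v t; rewrite /aa_lin /= expm0 mul1mx. Qed.

Lemma straighten_fst v0 v1 w : straighten v0 v1 (w, 0) = (w, 0) :> V.
Proof.
have E : expm_quo aleph 0 = 0 := expq0 J.
by rewrite /straighten /= E mul0mx subr0 scale0r addr0.
Qed.

Section Horizontal.
Variable W : {vspace 'cV[C]_(jdim aleph)}.
Hypothesis LW : [set x | x \in L] = [set x | x.1 \in W /\ x.2 = 0].

(** Tangent spaces are images of [L] under [aa_lin], which keeps the second coordinate; that
    coordinate is zero on [L], so it is constant along [H]. *)
Lemma ls_incl_snd_eq0 h : (iota h).2 = 0.
Proof.
have /seteqP[L1 _] := LW.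
have := @connected_const R H (snd \o iota) Hconn _ h 1%g.
rewrite /= ls_incl1; apply=> c ac z cz.
have dF := @ls_holo _ _ H c ac z cz.
have sc : continuous (snd : V -> C^o) by move=> q; exact: cvg_snd.
have ds := @linear_differentiable C V C^o snd ((iota \o ch_inv c) z) sc.
split; first exact: (differentiable_comp dF ds).
move=> v.
have /seteqP[T1 _] := tangent_range HL ac (ch_invP cz).
rewrite (ch_invK cz) in T1.
have [x xL E] := T1 _ (ex_intro2 _ _ v I erefl).
have E1 := congr1 (fun f : 'rV[C]_(lg_dim H) -> C^o => f v) (diff_comp dF ds).
have E2 u := congr1 (fun f : V -> C^o => f u)
  (@diff_lin C V C^o snd ((iota \o ch_inv c) z) sc).
refine (etrans E1 (etrans (E2 _) (etrans (congr1 snd (esym E)) _))).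
by have [_] := L1 _ xL.
Qed.

Lemma ls_incl_range_fst : range iota = [set x | x.1 \in W /\ x.2 = 0].
Proof.
have straight h :
    (fun x => dstraighten 0 0 (iota h) (aa_lin (iota h).2 x)) @` [set x | x \in L] =
    [set x | x \in L].
  apply/seteqP; split=> [_ [x xL <-]|x xL].
    by rewrite dstraighten00 ls_incl_snd_eq0 aa_lin0.
  by exists x => //; rewrite dstraighten00 ls_incl_snd_eq0 aa_lin0.
rewrite -LW; apply/seteqP; split=> [_ [h _ <-]|y yL].
  by have := straighten_incl_mem HL Hconn straight h; rewrite straighten00.
have [d d0 onto] := straighten_incl_locally_onto HL Hconn straight.
have [n [a na ad]] := small_multiple y d0.
have [|h hy] := onto (a *: y) _ ad; first exact: rpredZ.
have /seteqP[L1 _] := LW.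
have [_ y2] := L1 _ yL.
exists (h ^+ n)%g => //.
move: hy; rewrite straighten00 => hy.
have hy' : iota h = (a *: y.1, 0).
  by rewrite hy -y2; case: (y) y2 => u t /= ->; congr (_, _); rewrite /= scaler0.
rewrite (ls_incl_pow_fst n hy') -scaler_nat scalerA na scale1r -y2.
by case: (y).
Qed.

End Horizontal.

Section Transversal.
Variables (v0 : 'cV[C]_(jdim aleph)) (W : {vspace 'cV[C]_(jdim aleph)}).
Hypothesis JW : {in W, forall w, J *m w \in W}.
Hypothesis LW : [set x | x \in L] =
  [set x | exists2 w, w \in W & exists t, x = (w + t *: v0, t)].

(** The exponential terms in [v0] cancel, leaving [e^{tJ}] acting on [W] alone; it maps [W] onto
    itself, with inverse [e^{-tJ}]. *)
Let straight (h : H) :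
  (fun x => dstraighten v0 v0 (iota h) (aa_lin (iota h).2 x)) @` [set x | x \in L] =
  [set x | x \in L].
Proof.
have key (w : 'cV[C]_(jdim aleph)) (s : C^o) :
    dstraighten v0 v0 (iota h) (aa_lin (iota h).2 (w + s *: v0, s)) =
    (expm ((iota h).2 *: J) *m w + s *: v0, s).
  rewrite /dstraighten /aa_lin /=; move: (expm _) => e.
  by rewrite mulmxDr -scalemxAr addrK.
rewrite LW; apply/seteqP; split=> [_ [_ [w wW [s ->]] <-]|_ [w wW [s ->]]].
  exists (expm ((iota h).2 *: J) *m w); first exact: expm_invariant.
  by exists s; exact: key.
exists (expm (- (iota h).2 *: J) *m w + s *: v0, s).
  exists (expm (- (iota h).2 *: J) *m w); first exact: expm_invariant.
  by exists s.
by rewrite key mulmxA -expmD subrr expm0 mul1mx.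
Qed.

(** For the reverse inclusion, factor the element as [(w, 0)] times [(q(t) v0, t)]; each factor is a
    power of an element of [H] close to the unit. *)
Lemma ls_incl_range_transversal : range iota =
  [set x | exists2 w, w \in W & exists t, x = (w + expm_quo aleph t *m v0, t)].
Proof.
have /seteqP[L1 L2] := LW.
apply/seteqP; split=> [_ [h _ <-]|_ [w wW [t ->]]].
  have [w wW [s]] := L1 _ (straighten_incl_mem HL Hconn straight h).
  case: (iota h) => v t; rewrite /straighten /= => -[+ ts]; rewrite -ts => /addIr E.
  by exists w => //; exists t; rewrite -E subrK.
have [d d0 onto] := straighten_incl_locally_onto HL Hconn straight.
have [h1 Eh1] : exists h, iota h = (w, 0).
  have [n [a na ad]] := small_multiple (w : 'cV[C]_(jdim aleph), 0 : C^o) d0.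
  have wL : ((w, 0) : V) \in L by apply: L2; exists w => //; exists 0; rewrite scale0r addr0.
  have [|h] := onto (a *: (w, 0)) _ ad; first exact: rpredZ.
  rewrite (_ : a *: (w, 0) = (a *: w, 0) :> V); last by congr (_, _); rewrite /= scaler0.
  rewrite -{1}(straighten_fst v0 v0) => /straighten_inj E.
  by exists (h ^+ n)%g; rewrite (ls_incl_pow_fst n E) -scaler_nat scalerA na scale1r.
have [h2 Eh2] : exists h, iota h = (expm_quo aleph t *m v0, t).
  have [n [a na ad]] := small_multiple (t *: v0, t : C^o) d0.
  have tL : ((t *: v0, t) : V) \in L by apply: L2; exists 0; [exact: mem0v | exists t; rewrite add0r].
  have [|h] := onto (a *: (t *: v0, t)) _ ad; first exact: rpredZ.
  (* The small vector on the line is the straightening of the point at time [a * t] of the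
     one-parameter subgroup. *)
  rewrite (_ : a *: (t *: v0, t) = straighten v0 v0 (expm_quo aleph (a * t) *m v0, a * t)); last first.
    by rewrite /straighten /= subrr add0r -scalerA.
  move=> /straighten_inj E; exists (h ^+ n)%g.
  by rewrite (ls_incl_pow_quo n E) -mulr_natl mulrA na mul1r.
exists (h1 * h2)%g => //.
by rewrite ls_mul Eh1 Eh2 /aa_mul /= expm0 mul1mx add0r.
Qed.

End Transversal.

Lemma straightened_mul v0 (x y : H) :
  (straighten v0 0 \o iota) (x * y)%g =
  aa_mul ((straighten v0 0 \o iota) x) ((straighten v0 0 \o iota) y).
Proof. by rewrite /= ls_mul straighten_mul. Qed.

Lemma straightened_inj v0 : injective (straighten v0 0 \o iota).
Proof. by apply: inj_comp; [exact: straighten_inj | exact: ls_inj]. Qed.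

(* The Lie group [H] itself; only its inclusion changes. *)
Definition straightened v0 : lie_subgroup aleph :=
  @LieSubgroup R aleph H (straighten v0 0 \o iota) (@straightened_inj v0)
    (straightened_mul v0)
    (fun c ac z cz => @differentiable_straighten_incl R aleph H v0 0 c z ac cz)
    (fun c ac z cz => @straighten_incl_immersion R aleph H v0 0 c z ac cz).

Lemma straightened_isomorphic v0 : lie_isomorphic H (straightened v0).
Proof.
(* In charts the identity is a transition map of the atlas. *)
have hid : holomorphic_map (idfun : H -> H).
  by split=> [x|c c' ac ac' z cz cz']; [exact: cvg_id | exact: lg_transition].
by exists idfun, idfun; split.
Qed.

Lemma straightened_range v0 (W : {vspace 'cV[C]_(jdim aleph)}) :
  range iota = [set x | exists2 w, w \in W & exists t, x = (w + expm_quo aleph t *m v0, t)] ->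
  range (ls_incl (straightened v0)) =
    [set x | exists2 w, w \in W & exists t, x = (w, t)].
Proof.
have key w t : straighten v0 0 (w + expm_quo aleph t *m v0, t) = (w, t) :> V.
  by rewrite /straighten /=; move: (expm_quo aleph t) => q; rewrite addrK scaler0 addr0.
move=> /seteqP[R1 R2]; apply/seteqP; split=> [_ [h _ <-]|_ [w wW [t ->]]].
  have [w wW [t E]] := R1 _ (ex_intro2 _ _ h I erefl).
  by exists w => //; exists t; rewrite /= E key.
have [|h _ E] := R2 (w + expm_quo aleph t *m v0, t); first by exists w => //; exists t.
by exists h => //; rewrite /= E key.
Qed.

End Subgroups.

Theorem proposition6p2 (R : realType) (aleph : multiplicity R)
    (haa : almost_abelian aleph)
    (L : {vspace 'cV[cplx R]_(jdim aleph) * (cplx R)^o})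
    (hL : lie_subalgebra L)
    (H : lie_subgroup aleph)
    (hHconn : connected [set: H])
    (hHL : has_lie_algebra H L) :
  (forall W : {vspace 'cV[cplx R]_(jdim aleph)},
     [set x | x \in L] = [set x | x.1 \in W /\ x.2 = 0] ->
     lie_abelian L ->
     range (ls_incl H) = [set x | x.1 \in W /\ x.2 = 0] /\
     range (ls_incl H) = aa_exp aleph @` [set x | x \in L])
  /\
  (forall (v0 : 'cV[cplx R]_(jdim aleph))
          (W : {vspace 'cV[cplx R]_(jdim aleph)}),
     {in W, forall w, jordan aleph *m w \in W} ->
     [set x | x \in L] =
       [set x | exists2 w, w \in W & exists t, x = (w + t *: v0, t)] ->
     range (ls_incl H) =
       [set x | exists2 w, w \in W &
                exists t, x = (w + expm_quo aleph t *m v0, t)] /\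
     exists P : lie_subgroup aleph,
       range (ls_incl P) =
         [set x | exists2 w, w \in W & exists t, x = (w, t)] /\
       lie_isomorphic H P).
Proof.
split=> [W LW _|v0 W JW LW].
  have E := ls_incl_range_fst hHconn hHL LW.
  split=> //; rewrite E LW.
  by apply/seteqP; split=> [[w t] /= [wW ->]|_ [[w t] /= [wW ->] <-]];
    [exists (w, 0); rewrite ?aa_exp_fst | rewrite aa_exp_fst].
have E := ls_incl_range_transversal hHconn hHL JW LW.
(* The semidirect product is realised by [H] with its straightened inclusion. *)
split=> //; exists (straightened H v0); split; first exact: straightened_range.
exact: straightened_isomorphic.
Qed.
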